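(* Let $G=([d],E)$ be a connected graph and let $r<d$. If $J_{G,r}$ is the zero ideal, then the (surrogate) maximum likelihood estimate exists with probability $1$ for a generic sample variogram matrix of dimensionality $r$.
   Context: Let $I_r\subset\mathbb{C}[\sigma_{ij}\mid 1\le i\le j\le d]$ be the ideal of all $(r+1)\times(r+1)$ minors of the generic symmetric $d\times d$ matrix $\Sigma=(\sigma_{ij})$. Let $\Gamma$ be the generic symmetric $d\times d$ matrix with zero diagonal and off-diagonal entries the variables $\gamma_{ij}$, and $$\sigma(\Gamma)=\big(I-\tfrac1d\mathbf{1}\mathbf{1}^\top\big)\Big(-\frac{\Gamma}{2}\Big)\big(I-\tfrac1d\mathbf{1}\mathbf{1}^\top\big).$$ Let $J_r\subset\mathbb{C}[\gamma_{ij}\mid 1\le i<j\le d]$ be obtained from $I_r$ by the substitution $\Sigma=\sigma(\Gamma)$, and let $J_{G,r}=J_r\cap\mathbb{C}[\gamma_{ij}\mid (i,j)\in E]$ be the ideal obtained from $J_r$ by eliminating all variables $\gamma_{ij}$ with $(i,j)\notin E$. A variogram matrix is the matrix of pairwise squared Euclidean distances of $d$ points in a Euclidean space; its dimensionality is the minimal $m$ such that the points can be taken in $\mathbb{R}^m$, equivalently the rank of $\sigma(\overline\Gamma)$. A generic sample variogram matrix of dimensionality $r$ is $\overline\Gamma=\gamma(\overline\Sigma)$ for a generic positive semidefinite $\overline\Sigma$ of rank $r$ with $\overline\Sigma\mathbf{1}=\mathbf{0}$, where $\gamma(\Sigma)=d_\Sigma\mathbf{1}^\top+\mathbf{1}d_\Sigma^\top-2\Sigma$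 and $d_\Sigma$ is the diagonal of $\Sigma$ as a vector; ''with probability 1'' means for almost all such matrices. The surrogate maximum likelihood estimate for $\overline\Gamma$ and $G$ exists if the following matrix completion problem has a solution: find a strictly conditionally negative definite $\Gamma$ (real symmetric, zero diagonal, $v^\top\Gamma v<0$ for all $v\ne\mathbf{0}$, $v\perp\mathbf{1}$) with $\Gamma_{ij}=\overline\Gamma_{ij}$ for all $(i,j)\in E$ and $\theta(\Gamma)_{ij}=0$ for all $i\neq j$ with $(i,j)\notin E$, where $\theta(\Gamma)$ is the upper-left $d\times d$ block of the inverse of $\begin{pmatrix}-\Gamma/2&\mathbf{1}\\ \mathbf{1}^\top&0\end{pmatrix}$. *)

(* Defs.v *)
From HB Require Import structures.
From mathcomp Require Import all_boot all_order all_algebra.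
From mathcomp Require Import complex mpoly.
From mathcomp Require Import classical_sets boolp reals ereal sequences normedtype.

Set Implicit Arguments.
Unset Strict Implicit.
Unset Printing Implicit Defensive.

Import Order.TTheory GRing.Theory Num.Theory.

Local Open Scope classical_set_scope.
Local Open Scope ring_scope.

Section Ideals.

Variable A : comNzRingType.

Definition ideal_gen (S : set A) : set A :=
  [set p | exists (n : nat) (a g : 'I_n -> A),
     (forall i, S (g i)) /\ p = \sum_(i < n) a i * g i].

(* Row and column selections are strictly increasing, so that each minor
   occurs exactly once. *)
Definition minors (k d : nat) (M : 'M[A]_d) : set A :=
  [set p | exists f g : 'I_k -> 'I_d,
     [/\ {homo f : i j / (i < j)%N}, {homo g : i j / (i < j)%N}
       & p = \det (mxsub f g M)]].

End Ideals.

Section CayleyMenger.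

Variables (C : fieldType) (d : nat).

Definition le_pair := {p : 'I_d * 'I_d | (p.1 <= p.2)%N}.
Definition lt_pair := {p : 'I_d * 'I_d | (p.1 < p.2)%N}.

(* The polynomial rings C[sigma_ij | i <= j] and C[gamma_ij | i < j]: variables
   are numbered by the enumeration of the corresponding finite type of pairs. *)
Definition sigma_ring := {mpoly C[#|{: le_pair}|]}.
Definition gamma_ring := {mpoly C[#|{: lt_pair}|]}.

Definition sort_pair (i j : 'I_d) : 'I_d * 'I_d :=
  if (i <= j)%N then (i, j) else (j, i).

(* [insub] always succeeds here. *)
Definition generic_Sigma : 'M[sigma_ring]_d :=
  \matrix_(i, j)
    (if insub (sort_pair i j) is Some k then 'X_(enum_rank (k : le_pair)) else 0).

(* [insub] fails exactly on the diagonal, whose entries are therefore 0. *)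
Definition generic_Gamma : 'M[gamma_ring]_d :=
  \matrix_(i, j)
    (if insub (sort_pair i j) is Some k then 'X_(enum_rank (k : lt_pair)) else 0).

Definition centering : 'M[C]_d := 1%:M - d%:R^-1 *: const_mx 1.

Definition sigma_of_Gamma : 'M[gamma_ring]_d :=
  let P := map_mx (@mpolyC _ C) centering in
  P *m ((- 2%:R^-1 : C)%:MP *: generic_Gamma) *m P.

Definition subst_sigma (p : sigma_ring) : gamma_ring :=
  p \mPo [tuple sigma_of_Gamma (val (enum_val i)).1 (val (enum_val i)).2
         | i < #|{: le_pair}|].

Definition ideal_I (r : nat) : set sigma_ring :=
  ideal_gen (minors r.+1 generic_Sigma).

Definition ideal_J (r : nat) : set gamma_ring :=
  ideal_gen (subst_sigma @` ideal_I r).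

Definition edge_subring (e : rel 'I_d) : set gamma_ring :=
  [set p | forall m, m \in msupp p -> forall k : lt_pair,
     ~~ e (val k).1 (val k).2 -> m (enum_rank k) = 0%N].

Definition ideal_JG (e : rel 'I_d) (r : nat) : set gamma_ring :=
  ideal_J r `&` edge_subring e.

End CayleyMenger.

Section Variograms.

Variables (R : realType) (d : nat).

Definition psd (S : 'M[R]_d) : Prop :=
  S^T = S /\ forall v : 'cV[R]_d, 0 <= (v^T *m S *m v) 0 0.

Definition centered_psd (r : nat) : set 'M[R]_d :=
  [set S | [/\ psd S, \rank S = r & S *m (const_mx 1 : 'cV[R]_d) = 0]].

Definition diag_col (S : 'M[R]_d) : 'cV[R]_d := \col_i S i i.

Definition gamma_of (S : 'M[R]_d) : 'M[R]_d :=
  diag_col S *m const_mx 1 + const_mx 1 *m (diag_col S)^T - 2%:R *: S.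

Definition strictly_cnd (Gam : 'M[R]_d) : Prop :=
  [/\ Gam^T = Gam, forall i, Gam i i = 0
    & forall v : 'cV[R]_d, v != 0 -> v^T *m const_mx 1 = 0 :> 'M[R]_1 ->
        (v^T *m Gam *m v) 0 0 < 0].

(* The bordered matrix is invertible whenever [Gam] is strictly conditionally
   negative definite and d > 0, so [invmx] is the genuine inverse there. *)
Definition theta (Gam : 'M[R]_d) : 'M[R]_d :=
  ulsubmx (invmx (block_mx (- 2%:R^-1 *: Gam) (const_mx 1)
                           (const_mx 1) (0 : 'M[R]_1))).

Definition surrogate_mle_exists (e : rel 'I_d) (Gbar : 'M[R]_d) : Prop :=
  exists Gam : 'M[R]_d,
    [/\ strictly_cnd Gam,
        forall i j, e i j -> Gam i j = Gbar i j
      & forall i j, i != j -> ~~ e i j -> theta Gam i j = 0].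

End Variograms.

(* Unnormalized k-dimensional Hausdorff (outer) measure for the norm distance.
   Norms on matrices are equivalent and the normalizing constant is positive, so
   its null sets inside a k-dimensional submanifold of the space of matrices are
   those of the Riemannian volume of that submanifold. *)
Section Hausdorff.

Variables (R : realType) (V : normedModType R).

(* Equal to -oo on the empty set. *)
Definition diameter (U : set V) : \bar R :=
  ereal_sup [set z | exists x y, [/\ U x, U y & z = (`|x - y|)%:E]].

Definition hausdorff_gauge (k : nat) (U : set V) : \bar R :=
  if `[< U = set0 >] then 0%E else (diameter U ^+ k)%E.

Definition hausdorff_content (k : nat) (delta : R) (A : set V) : \bar R :=
  ereal_inf [set s | exists U : nat -> set V,
    [/\ A `<=` \bigcup_n U n,
        forall n, (diameter (U n) <= delta%:E)%E
      & s = (\sum_(n <oo) hausdorff_gauge k (U n))%E]].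

Definition hausdorff (k : nat) (A : set V) : \bar R :=
  ereal_sup [set hausdorff_content k delta A | delta in [set t : R | 0 < t]].

End Hausdorff.

(* The matrices of [centered_psd r] amount to positive semidefinite matrices of
   rank r on a (d-1)-dimensional space; for r < d they form a manifold of
   dimension r (d - 1) - r (r - 1) / 2. *)
Definition centered_psd_dim (d r : nat) : nat := (r * d.-1 - 'C(r, 2))%N.

(* "P holds for almost all positive semidefinite S of rank r with S 1 = 0". *)
Definition almost_all_centered_psd (R : realType) (d r : nat)
    (P : 'M[R]_d -> Prop) : Prop :=
  hausdorff (centered_psd_dim d r) (centered_psd r `&` [set S | ~ P S]) = 0%E.

(* Main.v *)
Require Import Defs.
From HB Require Import structures.
From mathcomp Require Import all_boot all_order all_algebra.
From mathcomp Require Import complex mpoly.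
From mathcomp Require Import classical_sets boolp reals ereal sequences normedtype.
From mathcomp Require Import functions cardinality interval_inference topology derive esum.
From mathcomp Require Import perm zify ring lra.
From mathcomp Require Import generic_quotient ring_quotient fraction.

(** Fix a centered positive semidefinite matrix S = X X^T. For weights w on the
    edges let L(w) = sum_k w_k b_k b_k^T be the weighted Laplacian, b_k being the
    difference of the standard basis vectors at the ends of k; tr (S L(w)) is the
    sum of the squared edge lengths of the configuration X weighted by w.

    Existence is a matter of convexity. The estimate solves the stationarity
    equations of a log-determinant program over the Laplacians of the graph, and
    it exists as soon as no nonzero positive semidefinite L(w) satisfies
    tr (S L(w)) = 0 ([surrogate_mle_of_no_stress]). By homogeneity the logarithm
    can be avoided: the determinant is maximized on the slice tr (S L(w)) = 1 of
    the cone, which is then compact.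

    If such an L(w) exists, then L(w) X = 0, that is, w is an equilibrium stress
    of X. Differentiating the weighted sum of squared edge lengths shows that w
    is a linear relation between the gradients of the squared edge lengths at X
    ([stress_gradient]). So it suffices that for almost all S these gradients
    are linearly independent.

    This is where J_{G,r} = 0 enters. A polynomial relation between the squared
    edge lengths of d points in real r-space persists over any extension field for
    symmetric matrices of rank at most r ([gram_identity_transfer]), because
    they are all of the form B^T (N + N^T) B. It is applied in the residue field
    of a prime ideal that contains J_r and no nonzero polynomial in the edge
    variables; the relation holds for the image of the generic matrix, so it is
    zero ([edge_distances_independent]). Algebraically independent polynomials
    have, in characteristic 0, linearly independent gradients outside the zero
    set of some nonzero polynomial g ([jacobian_criterion]).

    For the measure, a rotation makes X lower trapezoidal with column sums 0
    ([gram_chart_surj]). The number of free entries is exactly the dimension of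
    the manifold ([card_position]), so the exceptional matrices lie in the image
    of the zero set of g under a polynomial map from a space of that dimension,
    and such an image is null ([null_zeros]). *)

Set Implicit Arguments.
Unset Strict Implicit.
Unset Printing Implicit Defensive.

Import Order.TTheory GRing.Theory Num.Theory.
Import numFieldNormedType.Exports numFieldTopology.Exports.
Local Open Scope classical_set_scope.
Local Open Scope ring_scope.

(** * Prime ideals and residue fields *)

Section PrimeIdeals.

Variable A : comNzRingType.
Implicit Types I J S : set A.

Definition is_ideal I :=
  [/\ I 0, forall x y, I x -> I y -> I (x + y) & forall a x, I x -> I (a * x)].

Definition is_prime I := ~ I 1 /\ forall x y, I (x * y) -> I x \/ I y.

Lemma is_ideal_gen S : is_ideal (ideal_gen S).
Proof.
split=> [|x y [n [a [g [Sg ->]]]] [m [b [h [Sh ->]]]]|c x [n [a [g [Sg ->]]]]].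
- by exists 0%N, (fun=> 0), (fun=> 0); split=> [[]//|]; rewrite big_ord0.
- exists (n + m)%N, (fun i => match fintype.split i with inl j => a j | inr j => b j end),
    (fun i => match fintype.split i with inl j => g j | inr j => h j end).
  split=> [i|]; first by case: fintype.split.
  rewrite big_split_ord /=; congr (_ + _); apply: eq_bigr => i _.
    by rewrite (unsplitK (inl i : 'I_n + 'I_m)).
  by rewrite (unsplitK (inr i : 'I_n + 'I_m)).
exists n, (fun i => c * a i), g; split=> //.
by rewrite mulr_sumr; apply: eq_bigr => i _; rewrite mulrA.
Qed.

Lemma ideal_gen_sub S x : S x -> ideal_gen S x.
Proof.
by move=> Sx; exists 1%N, (fun=> 1), (fun=> x); split=> //; rewrite big_ord1 mul1r.
Qed.

(** An ideal maximal among those that contain [J] and avoid the multiplicative set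
    [S] is prime. *)
Lemma exists_prime_avoiding J S : is_ideal J -> S 1 ->
  (forall x y, S x -> S y -> S (x * y)) -> (forall x, J x -> ~ S x) ->
  exists I, [/\ is_ideal I, is_prime I, J `<=` I & forall x, I x -> ~ S x].
Proof.
move=> idJ S1 SM JS.
pose Q I := [/\ is_ideal I, J `<=` I & forall x, I x -> ~ S x].
pose P : set (set A) := [set I | I = set0 \/ Q I].
have [F FP tot|I [PI maxI]] := @Zorn_bigcup A P.
  (* The empty set is admitted in [P] to serve as the union of the empty chain. *)
  have [[I0 [FI0 nz]]|no] := pselect (exists I, F I /\ I <> set0); last first.
    left; rewrite -subset0 => x [I FI Ix]; apply: no; exists I; split=> // I0.
    by rewrite I0 in Ix.
  have QF I x : F I -> I x -> Q I.
    by move=> FI Ix; case: (FP _ FI) => // I0'; rewrite I0' in Ix.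
  have QI0 : Q I0 by case: (FP _ FI0).
  right; split; first split.
  - by exists I0 => //; case: QI0 => -[].
  - move=> x y [I FI Ix] [I' FI' Iy].
    have [II'|I'I] := tot _ _ FI FI'.
      exists I' => //; have [[_ addI _] _ _] := QF _ _ FI' Iy.
      by apply: addI => //; exact: II'.
    exists I => //; have [[_ addI _] _ _] := QF _ _ FI Ix.
    by apply: addI => //; exact: I'I.
  - move=> a x [I FI Ix]; exists I => //.
    by have [[_ _ mulI] _ _] := QF _ _ FI Ix; exact: mulI.
  - by move=> x Jx; exists I0 => //; case: QI0 => _ + _; exact.
  - by move=> x [I FI Ix]; have [_ _] := QF _ _ FI Ix; exact.
have QI : Q I.
  case: PI => // I0; exfalso; apply: (maxI J).
    by rewrite I0; split=> // /(_ 0); apply; case: idJ.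
  by right; split.
have [[I_0 I_D I_M] JI IS] := QI.
exists I; split=> //; split; first by move=> /IS.
(* Both I + (x) and I + (y) meet S, hence so does I + (xy). *)
move=> x y Ixy; apply: contrapT => /not_orP [nx ny].
have ext z : ~ I z -> exists a s, S s /\ I (s - a * z).
  move=> nz; pose I' := [set t | exists a, I (t - a * z)].
  apply: contrapT => no; apply: (maxI I').
    split=> [t It|/(_ z)]; first by exists 0; rewrite mul0r subr0.
    move=> h; apply: nz; apply: h; exists 1; by rewrite mul1r subrr.
  right; split; first split.
  - by exists 0; rewrite mul0r subr0.
  - move=> u v [a Ia] [b Ib]; exists (a + b).
    by rewrite mulrDl opprD addrACA; exact: I_D.
  - by move=> a u [b Ib]; exists (a * b); rewrite -mulrA -mulrBr; exact: I_M.
  - by move=> t /JI It; exists 0; rewrite mul0r subr0.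
  - by move=> t [a Ia] St; apply: no; exists a, t.
have [a [s [Ss Is]]] := ext _ nx; have [b [t [St It]]] := ext _ ny.
apply: (IS (s * t)); last exact: SM.
have -> : s * t = t * (s - a * x) + a * x * (t - b * y) + a * b * (x * y).
  rewrite !mulrBr; rewrite (mulrC t s) (mulrC t (a * x)) mulrACA.
  by rewrite addrA subrK subrK.
by apply: (I_D); [apply: (I_D)|]; exact: I_M.
Qed.

End PrimeIdeals.

Section ResidueField.

Variables (A : comNzRingType) (I : set A).
Hypotheses (idI : is_ideal I) (prI : is_prime I).

Let inI : A -> bool := fun x => `[< I x >].

Let inI_zmod : zmod_closed inI.
Proof.
case: idI => I_0 I_D I_M; split=> [|x y]; rewrite !unfold_in; first exact/asboolP.
move=> /asboolP Ix /asboolP Iy; apply/asboolP; apply: I_D => //.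
by rewrite -mulN1r; exact: I_M.
Qed.

Let inI_proper : 1 \notin inI /\ forall a, {in inI, forall u, a * u \in inI}.
Proof.
case: idI prI => I_0 I_D I_M [I1 _]; split=> [|a x]; rewrite !unfold_in.
  exact/asboolP.
by move=> /asboolP Ix; apply/asboolP; exact: I_M.
Qed.

Let inI_prime : prime_idealr_closed inI.
Proof.
case: prI => _ pr x y; rewrite !unfold_in => /asboolP /pr [] h; apply/orP.
  by left; apply/asboolP.
by right; apply/asboolP.
Qed.

HB.instance Definition _ := GRing.isZmodClosed.Build A inI inI_zmod.
HB.instance Definition _ := isProperIdeal.Build A inI inI_proper.
HB.instance Definition _ := isPrimeIdealrClosed.Build A inI inI_prime.

Let J : prime_idealr A := inI.
Let Q : Type := {ideal_quot J}.
HB.instance Definition _ := GRing.ComNzRing.on Q.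

Let unitQ : pred Q := fun x => `[< exists y, y * x = 1 >].
Let invQ (x : Q) : Q :=
  if pselect (exists y, y * x = 1) is left ex then projT1 (cid ex) else x.

Let mulVQ : {in unitQ, left_inverse 1 invQ *%R}.
Proof.
move=> x /asboolP ex; rewrite /invQ; case: pselect => // ex'.
by case: cid.
Qed.

Let unitQPl (x y : Q) : y * x = 1 -> unitQ x.
Proof. by move=> yx; apply/asboolP; exists y. Qed.

Let invQ_out : {in [predC unitQ], invQ =1 id}.
Proof.
move=> x; rewrite inE => /asboolP nx; rewrite /invQ.
by case: pselect => // ex; case: nx.
Qed.

HB.instance Definition _ := GRing.ComNzRing_hasMulInverse.Build Q
  mulVQ unitQPl invQ_out.

HB.instance Definition _ := GRing.ComUnitRing_isIntegral.Build Q
  (@Quotient.rquot_IdomainAxiom A J).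

(** The fraction field of the quotient. Units and inverses in the quotient are
    chosen classically, only to make it an integral domain in the hierarchy. *)
Lemma exists_residue_field :
  exists (K : fieldType) (rho : {rmorphism A -> K}), forall x, rho x = 0 <-> I x.
Proof.
pose pi : A -> Q := \pi_(Q)%qT.
have pi_add : zmod_morphism pi by exact: pi_is_zmod_morphism.
have pi_mul : monoid_morphism pi by exact: pi_is_monoid_morphism.
pose addpi := GRing.isZmodMorphism.Build A Q pi pi_add.
pose mulpi := GRing.isMonoidMorphism.Build A Q pi pi_mul.
pose rpi : {rmorphism A -> Q} := HB.pack pi addpi mulpi.
exists {fraction Q}, (@FracField.tofrac Q \o rpi) => x /=.
have -> : FracField.tofrac (pi x) = 0 <-> pi x = 0.
  by split=> [/eqP|->]; rewrite ?tofrac_eq0 ?tofrac0 => // /eqP.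
have -> : pi x = 0 <-> x \in inI; last by split=> /asboolP.
have -> : 0 = pi 0 by rewrite [pi 0]raddf0.
split=> [/eqP|xI]; last apply/eqP; by rewrite -Quotient.idealrBE subr0.
Qed.

End ResidueField.

(** * Polynomials, algebraic independence and gradients *)

Section PolynomialGeneralities.

Variables (n : nat) (F : comNzRingType).

(** Induction along the ring structure, for statements that are compatible with
    products, such as the chain rule. *)
Lemma mpoly_ring_ind (P : {mpoly F[n]} -> Prop) :
  (forall c, P c%:MP) -> (forall i, P 'X_i) ->
  (forall p q, P p -> P q -> P (p + q)) ->
  (forall p q, P p -> P q -> P (p * q)) -> forall p, P p.
Proof.
move=> PC PX PD PM; elim/mpolyind => [|c m p _ _ Pp]; first by rewrite -mpolyC0.
apply: (PD) => //; rewrite -mul_mpolyC; apply: (PM) => //.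
rewrite mpolyXE_id; apply: big_ind => //; first by rewrite -mpolyC1.
move=> i _; elim: (m i) => [|j IH]; first by rewrite expr0 -mpolyC1.
by rewrite exprS; apply: PM.
Qed.

Lemma mderiv_var (i j : 'I_n) : ('X_i : {mpoly F[n]})^`M(j) = (i == j)%:R.
Proof.
rewrite mderivX mnm1E; case: (i =P j) => [->|_]; last by rewrite scale0r.
have -> : (U_(j) - U_(j))%MM = 0%MM :> 'X_{1..n}.
  by apply/mnmP => a; rewrite mnmBE subnn mnm0E.
by rewrite mpolyX0 scale1r.
Qed.

(** Stated through the support, as in [edge_subring]. *)
Definition vars_in (A : {set 'I_n}) (p : {mpoly F[n]}) :=
  forall m, m \in msupp p -> forall a, a \notin A -> m a = 0%N.

Lemma vars_inC A c : vars_in A c%:MP.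
Proof.
by move=> m; rewrite msuppC; case: eqP => // _; rewrite inE => /eqP-> a; rewrite mnm0E.
Qed.

Lemma vars_inX (A : {set 'I_n}) a : a \in A -> vars_in A 'X_a.
Proof.
move=> aA m; rewrite msuppX inE => /eqP-> b bA; rewrite mnm1E.
by case: eqP => // ab; rewrite -ab aA in bA.
Qed.

Lemma vars_inD A p q : vars_in A p -> vars_in A q -> vars_in A (p + q).
Proof.
by move=> hp hq m /msuppD_le; rewrite mem_cat => /orP[]; [exact: hp|exact: hq].
Qed.

Lemma vars_inM A p q : vars_in A p -> vars_in A q -> vars_in A (p * q).
Proof.
move=> hp hq m /msuppM_le /allpairsP[[m1 m2] /= [h1 h2 ->]] a aA.
by rewrite mnmDE (hp _ h1) // (hq _ h2).
Qed.

Lemma vars_in_sum A I (r : seq I) (P : pred I) f :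
  (forall i, P i -> vars_in A (f i)) -> vars_in A (\sum_(i <- r | P i) f i).
Proof.
by move=> h; apply: big_ind => //; [rewrite -mpolyC0; exact: vars_inC|exact: vars_inD].
Qed.

Lemma vars_in_deriv A p i : vars_in A p -> vars_in A p^`M(i).
Proof.
move=> hp m; rewrite mcoeff_msupp mcoeff_deriv => nz a aA.
have /hp/(_ a aA) : (m + U_(i))%MM \in msupp p.
  by rewrite mcoeff_msupp; apply: contraNneq nz => ->; rewrite mul0rn.
by rewrite mnmDE => /eqP; rewrite addn_eq0 => /andP[/eqP].
Qed.

Lemma eq_mmap_vars_in (S : comNzRingType) (f : {rmorphism F -> S})
    (g h : 'I_n -> S) A p :
  vars_in A p -> {in A, g =1 h} -> mmap f g p = mmap f h p.
Proof.
move=> hp gh; rewrite /mmap; apply: eq_big_seq => m /hp mA; congr (_ * _).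
apply: eq_bigr => i _; case: (boolP (i \in A)) => [/gh->//|/mA->].
by rewrite !expr0.
Qed.

Lemma rmorph_mmap (S T : comNzRingType) (f : {rmorphism F -> S})
    (phi : {rmorphism S -> T}) (h : 'I_n -> S) p :
  phi (mmap f h p) = mmap (phi \o f) (phi \o h) p.
Proof.
rewrite /mmap rmorph_sum; apply: eq_bigr => m _; rewrite rmorphM; congr (_ * _).
by rewrite rmorph_prod; apply: eq_bigr => i _; rewrite rmorphXn.
Qed.

End PolynomialGeneralities.

Section Substitution.

Variables (n k : nat) (F : comNzRingType).

(** Unlike [comp_mpoly], the substituted polynomials form a function. *)
Definition msubst (h : 'I_n -> {mpoly F[k]}) (p : {mpoly F[n]}) : {mpoly F[k]} :=
  mmap (@mpolyC k F) h p.

Fact msubst_zmod_morphism h : zmod_morphism (msubst h).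
Proof. by move=> p q; rewrite /msubst raddfB. Qed.

Fact msubst_monoid_morphism h : monoid_morphism (msubst h).
Proof. by split=> [|p q]; rewrite /msubst (rmorph1, rmorphM). Qed.

HB.instance Definition _ h :=
  GRing.isZmodMorphism.Build _ _ (msubst h) (msubst_zmod_morphism h).
HB.instance Definition _ h :=
  GRing.isMonoidMorphism.Build _ _ (msubst h) (msubst_monoid_morphism h).

Lemma msubstX h i : msubst h 'X_i = h i.
Proof. by rewrite /msubst mmapX mmap1U. Qed.

Lemma msubstC h c : msubst h c%:MP = c%:MP.
Proof. by rewrite /msubst mmapC. Qed.

Lemma msubstZ h c p : msubst h (c *: p) = c *: msubst h p.
Proof. by rewrite -!mul_mpolyC rmorphM /= msubstC. Qed.

Lemma vars_in_msubst h A p :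
  (forall a, vars_in A (h a)) -> vars_in A (msubst h p).
Proof.
move=> hA; elim/mpoly_ring_ind: p => [c|i|p q hp hq|p q hp hq].
- by rewrite msubstC; exact: vars_inC.
- by rewrite msubstX.
- by rewrite rmorphD /=; exact: vars_inD.
- by rewrite rmorphM /=; exact: vars_inM.
Qed.

Lemma meval_msubst h p v : (msubst h p).@[v] = p.@[fun a => (h a).@[v]].
Proof.
elim/mpoly_ring_ind: p => [c|i|p q hp hq|p q hp hq].
- by rewrite msubstC !mevalC.
- by rewrite msubstX mevalXU.
- by rewrite rmorphD /= !mevalD hp hq.
- by rewrite rmorphM /= !mevalM hp hq.
Qed.

Lemma mderiv_msubst h p l :
  (msubst h p)^`M(l) = \sum_a msubst h p^`M(a) * (h a)^`M(l).
Proof.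
elim/mpoly_ring_ind: p => [c|i|p q hp hq|p q hp hq].
- rewrite msubstC mderivC big1 // => a _.
  by rewrite mderivC raddf0 mul0r.
- rewrite msubstX (bigD1 i) //= big1 ?addr0 => [|a ai].
    by rewrite mderiv_var eqxx rmorph1 mul1r.
  by rewrite mderiv_var eq_sym (negbTE ai) raddf0 mul0r.
- rewrite rmorphD /= mderivD hp hq -big_split; apply: eq_bigr => a _.
  by rewrite mderivD rmorphD /= mulrDl.
- rewrite rmorphM /= mderivM hp hq mulr_suml mulr_sumr -big_split.
  apply: eq_bigr => a _.
  by rewrite mderivM rmorphD !rmorphM /= mulrDl /= mulrAC -!mulrA.
Qed.

End Substitution.

Section AlgebraicIndependence.

Variables (F : fieldType) (k N : nat) (h : 'I_N -> {mpoly F[k]}).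

Definition alg_indep (A : {set 'I_N}) :=
  forall p, vars_in A p -> msubst h p = 0 -> p = 0.

Let deg_le b n (p : {mpoly F[n]}) := forall m, m \in msupp p -> (mdeg m <= b)%N.

Let deg_leM a b n (p q : {mpoly F[n]}) :
  deg_le a p -> deg_le b q -> deg_le (a + b) (p * q).
Proof.
move=> hp hq m /msuppM_le /allpairsP[[m1 m2] /= [h1 h2 ->]].
by rewrite mdegD leq_add ?hp ?hq.
Qed.

Let deg_leX a j n (p : {mpoly F[n]}) : deg_le a p -> deg_le (j * a) (p ^+ j).
Proof.
move=> hp; elim: j => [|j IH]; last by rewrite exprS mulSn; exact: deg_leM.
by move=> m; rewrite expr0 msupp1 inE => /eqP->; rewrite mdeg0.
Qed.

Let deg_le_prod I (r : seq I) n (f : I -> {mpoly F[n]}) a b :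
  (forall i, deg_le (a i) (f i)) -> (forall i, (a i <= b)%N) ->
  deg_le (size r * b) (\prod_(i <- r) f i).
Proof.
move=> hf ab; elim: r => [|i r IH].
  by move=> m; rewrite big_nil msupp1 inE => /eqP->; rewrite mdeg0.
rewrite big_cons mulSn; apply: deg_leM => // m /hf /leq_trans; exact.
Qed.

(** Dimension count: the monomials of degree at most D in each of k + 1 variables
    number (D + 1)^(k+1), and substitution maps them to polynomials in k variables
    of degree O(D), a space of dimension O(D^k). For large D they become linearly
    dependent. *)
Lemma card_alg_indep A : alg_indep A -> (#|A| <= k)%N.
Proof.
move=> indA; rewrite leqNgt; apply/negP => ltkA.
pose s (j : 'I_k.+1) : 'I_N := enum_val (widen_ord ltkA j).
have s_inj : injective s by move=> i j /enum_val_inj /(congr1 val) /= /val_inj.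
have sA j : s j \in A by exact: enum_valP.
(* C^k is the value of D for which (D + 1)^(k+1) exceeds (B + 1)^k. *)
pose c := (\max_a msize (h a)).+1.
have hc a : deg_le c (h a).
  move=> m /msize_mdeg_lt /ltnW /leq_trans; apply.
  by rewrite leqW //; exact: (leq_bigmax (F := fun a => msize (h a)) a).
pose C := (k.+1 * c)%N; pose D := (C ^ k)%N; pose B := (k.+1 * (D * c))%N.
have C_gt0 : (0 < C)%N by rewrite muln_gt0.
pose T := {ffun 'I_k.+1 -> 'I_D.+1}; pose U := {ffun 'I_k -> 'I_B.+1}.
have cardUT : (#|{: U}| < #|{: T}|)%N.
  rewrite !card_ffun !card_ord.
  have leB : (B.+1 <= C * D.+1)%N by rewrite /B /C; nia.
  apply: (@leq_ltn_trans ((C * D.+1) ^ k)).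
    by case: (posnP k) => [->//|k0]; rewrite leq_exp2r.
  by rewrite expnMn expnS ltn_pmul2r // expn_gt0.
pose mon (t : T) : 'X_{1..N} := (\sum_j U_(s j) *+ t j)%MM.
have mon_s t j : mon t (s j) = t j.
  rewrite /mon mnm_sumE (bigD1 j) //= mulmnE mnm1E eqxx mul1n big1 ?addn0 // => i ij.
  by rewrite mulmnE mnm1E (inj_eq s_inj) (negbTE ij) mul0n.
have mon_inj : injective mon.
  move=> t t' /mnmP e; apply/ffunP => j; apply/val_inj => /=.
  by have := e (s j); rewrite !mon_s.
have mon_A t a : a \notin A -> mon t a = 0%N.
  move=> aA; rewrite /mon mnm_sumE big1 // => j _; rewrite mulmnE mnm1E.
  by case: eqP => // sa; rewrite -sa sA in aA.
have deg_mon t : deg_le B (msubst h 'X_[mon t]).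
  have -> : msubst h 'X_[mon t] = \prod_j h (s j) ^+ t j.
    rewrite /mon -mprodXE rmorph_prod; apply: eq_bigr => j _.
    by rewrite -mpolyXn rmorphXn /= msubstX.
  have -> : B = (size (index_enum 'I_k.+1) * (D * c))%N.
    by rewrite /index_enum; unlock; rewrite -enumT size_enum_ord.
  apply: (deg_le_prod (a := fun j => (t j * c)%N)) => j; first exact: deg_leX.
  by rewrite leq_mul2r -ltnS ltn_ord orbT.
pose mnmU (u : U) : 'X_{1..k} := [multinom (u i : nat) | i < k].
pose M := \matrix_(i < #|{: T}|, j < #|{: U}|)
  (msubst h 'X_[mon (enum_val i)])@_(mnmU (enum_val j)).
have : kermx M != 0.
  rewrite -mxrank_eq0 mxrank_ker -lt0n subn_gt0.
  exact: leq_ltn_trans (rank_leq_col M) cardUT.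
move=> /rowV0Pn[v /sub_kermxP vM v0].
pose p : {mpoly F[N]} := \sum_i v 0 i *: 'X_[mon (enum_val i)].
have coef_p i : p@_(mon (enum_val i)) = v 0 i.
  rewrite /p raddf_sum (bigD1 i) //= mcoeffZ mcoeffX eqxx mulr1 big1 ?addr0 //.
  move=> j ji; rewrite mcoeffZ mcoeffX (inj_eq mon_inj) (inj_eq enum_val_inj).
  by rewrite (negbTE ji) mulr0.
move/negP: v0; apply; apply/eqP/rowP => i; rewrite mxE -coef_p.
rewrite (indA p) ?mcoeff0 //.
  apply: vars_in_sum => j _; rewrite -mul_mpolyC; apply: vars_inM; first exact: vars_inC.
  by move=> m; rewrite msuppX inE => /eqP-> a; exact: mon_A.
apply/mpolyP => m; rewrite mcoeff0.
have -> : msubst h p = \sum_i v 0 i *: msubst h 'X_[mon (enum_val i)].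
  by rewrite /p raddf_sum; apply: eq_bigr => j _; rewrite /= msubstZ.
case: (leqP (mdeg m) B) => [mB|Bm]; last first.
  rewrite raddf_sum big1 // => j _ /=; rewrite mcoeffZ.
  have /memN_msupp_eq0-> : m \notin msupp (msubst h 'X_[mon (enum_val j)]).
    by apply/negP => /deg_mon; rewrite leqNgt Bm.
  by rewrite mulr0.
pose u : U := [ffun i => inord (m i)].
have um : mnmU u = m.
  apply/mnmP => a; rewrite mnmE ffunE inordK // ltnS (leq_trans _ mB) //.
  by rewrite mdegE (bigD1 a) //= leq_addr.
move/matrixP/(_ 0 (enum_rank u)): vM; rewrite !mxE raddf_sum => vM.
rewrite -[RHS]vM; apply: eq_bigr => j _ /=.
by rewrite mcoeffZ !mxE enum_rankK um.
Qed.

Hypothesis F0 : [pchar F] =i pred0.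

Lemma vars_in_deriv0 (A : {set 'I_N}) i (p : {mpoly F[N]}) :
  vars_in (i |: A) p -> p^`M(i) = 0 -> vars_in A p.
Proof.
move=> hp dp m mp a aA; have [ai|ai] := eqVneq a i; last first.
  by apply: hp mp _ _; rewrite !inE negb_or ai.
rewrite {a}ai in aA *; apply/eqP; apply: contraLR mp => mi.
have := mcoeff_deriv i (m - U_(i))%MM p; rewrite dp mcoeff0 submK; last first.
  by apply/mnm_lepP => l; rewrite mnm1E; case: eqP => // <-; rewrite lt0n.
move/esym/eqP; rewrite -mulr_natr mulf_eq0 => /orP[|].
  by rewrite mcoeff_eq0.
by rewrite (iffLR (pcharf0P F) F0).
Qed.

Lemma msize_deriv (i : 'I_N) (p : {mpoly F[N]}) :
  p^`M(i) != 0 -> (msize p^`M(i) < msize p)%N.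
Proof.
move=> nz; rewrite -(mlead_deg nz).
have := mlead_supp nz; rewrite mcoeff_msupp mcoeff_deriv => nz'.
have /msize_mdeg_lt : (mlead p^`M(i) + U_(i))%MM \in msupp p.
  by rewrite mcoeff_msupp; apply: contraNneq nz' => ->; rewrite mul0rn.
by rewrite mdegD mdeg1 addn1.
Qed.

(** A relation of least degree has a nonzero derivative at the point [h]: in
    characteristic 0 the derivative is a nonzero polynomial, of lower degree. *)
Lemma alg_dep_relation A i : alg_indep A -> ~ alg_indep (i |: A) ->
  exists p, msubst h p = 0 /\ vars_in (i |: A) p /\ msubst h p^`M(i) != 0.
Proof.
move=> indA depA.
have [p [pA hp nzp]] : exists p, [/\ vars_in (i |: A) p, msubst h p = 0 & p != 0].
  apply: contrapT => no; apply: depA => p pA hp; apply: contrapT => /eqP nzp.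
  by apply: no; exists p.
elim: (msize p) {-2}p (leqnn (msize p)) pA hp nzp => {p} [|b IH] p pb pA hp nzp.
  by move: pb nzp; rewrite leqn0 msize_poly_eq0 => ->.
have nzd : p^`M(i) != 0.
  apply: contraNneq nzp => dp; apply/eqP; apply: indA hp.
  exact: vars_in_deriv0 pA dp.
have [hd|] := eqVneq (msubst h p^`M(i)) 0; last by exists p.
apply: (IH p^`M(i)) => //; last exact: vars_in_deriv.
by rewrite -ltnS; exact: leq_trans (msize_deriv nzd) pb.
Qed.

(** The family consists of the polynomials of interest together with all the
    coordinates. Extend [E] to a maximal independent subset [A]. Each coordinate
    is algebraic over [A]; differentiating a relation of least degree expresses a
    nonzero multiple of the gradient of this coordinate through the gradients of
    the members of [A]. So, where the product g of these multipliers is nonzero,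
    the gradients of the members of [A] span a space of dimension k; as [A] has at
    most k members, they are linearly independent. *)
Lemma jacobian_criterion (E : {set 'I_N}) :
  (forall l, exists a, h a = 'X_l) -> alg_indep E ->
  exists2 g : {mpoly F[k]}, g != 0 & forall y, g.@[y] != 0 ->
    forall w : 'I_N -> F, (forall a, a \notin E -> w a = 0) ->
    (forall l, \sum_a w a * ((h a)^`M(l)).@[y] = 0) -> forall a, w a = 0.
Proof.
move=> hX indE.
pose P (A : {set 'I_N}) := `[< alg_indep A >].
have PE : P E by apply/asboolP.
have [A /maxsetP[/asboolP indA maxA] EA] := maxset_exists PE.
(* Row l of C and entry d l of D: the relation between A and the l-th variable. *)
have rel l : exists (c : 'I_N -> {mpoly F[k]}) (d : {mpoly F[k]}),
    [/\ d != 0, forall a, a \notin A -> c a = 0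
      & forall j, \sum_a c a * (h a)^`M(j) = (l == j)%:R * d].
  have [i hi] := hX l.
  have dX j : (h i)^`M(j) = (l == j)%:R by rewrite hi mderiv_var.
  have [iA|iA] := boolP (i \in A).
    exists (fun a => (a == i)%:R), 1; split=> [|a aA|j]; first exact: oner_neq0.
      by case: eqP => // ai; rewrite ai iA in aA.
    rewrite (bigD1 i) //= eqxx mul1r big1 ?addr0 ?mulr1 // => a /negbTE->.
    by rewrite mul0r.
  have [|p [hp [pA dp]]] := @alg_dep_relation A i indA.
    move=> /asboolP indiA; move: iA; rewrite -(maxA _ indiA) ?setU11 //.
    by rewrite finset.subsetUr.
  exists (fun a => if a \in A then msubst h p^`M(a) else 0), (- msubst h p^`M(i)).
  split=> [|a /negbTE->//|j]; first by rewrite oppr_eq0.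
  have := mderiv_msubst h p j; rewrite hp raddf0 (bigD1 i) //= dX => /esym/eqP.
  rewrite addr_eq0 mulrC => /eqP/(congr1 -%R); rewrite opprK mulrN => ->.
  rewrite (bigD1 i) //= (negbTE iA) mul0r add0r; apply: eq_bigr => a ai.
  case: ifP => // /negbT aA; rewrite [p^`M(a)](_ : _ = 0) ?raddf0 //.
  apply/mpolyP => m; rewrite mcoeff_deriv mcoeff0.
  rewrite memN_msupp_eq0 ?mul0rn //; apply/negP => /pA/(_ a).
  by rewrite !inE negb_or ai aA mnmDE mnm1E eqxx addn1 => /(_ isT).
have [c /choice[d cd]] := choice rel.
have d0 l : d l != 0 by have [] := cd l.
have cA l a : a \notin A -> c l a = 0 by have [_ + _] := cd l; exact.
have cdE l j : \sum_a c l a * (h a)^`M(j) = (l == j)%:R * d l by have [] := cd l.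
exists (\prod_l d l); first by apply/prodf_neq0 => l _.
move=> y; rewrite rmorph_prod /= => /prodf_neq0 dy w wE wJ.
pose n := #|A|.
pose J := \matrix_(a < n, l < k) ((h (enum_val a))^`M(l)).@[y].
pose C := \matrix_(l < k, a < n) (c l (enum_val a)).@[y].
have CJ : C *m J = diag_mx (\row_l (d l).@[y]).
  apply/matrixP => l j; rewrite !mxE.
  transitivity ((\sum_a c l a * (h a)^`M(j)).@[y]).
    rewrite raddf_sum /= (bigID (mem A)) /= [X in _ + X]big1 ?addr0 => [|a aA].
      rewrite [RHS]big_enum_val; apply: eq_bigr => a _.
      by rewrite !mxE mevalM.
    by rewrite cA // mul0r meval0.
  by rewrite cdE mevalM; case: eqP => _; rewrite ?meval1 ?meval0 ?mul1r ?mul0r.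
have freeJ : row_free J.
  rewrite /row_free eqn_leq rank_leq_row (leq_trans (card_alg_indep indA)) //.
  suff : row_full J by move/eqP->.
  rewrite -sub1mx; apply/submxP.
  exists (diag_mx (\row_l ((d l).@[y])^-1) *m C).
  rewrite -mulmxA CJ mulmx_diag -diag_const_mx; congr diag_mx.
  by apply/rowP => l; rewrite !mxE mulVf // dy.
pose u := \row_(a < n) w (enum_val a).
have uJ : u *m J = 0.
  apply/rowP => l; rewrite !mxE -[RHS](wJ l) (bigID (mem A)) /=.
  rewrite [X in _ = _ + X]big1 ?addr0 => [|a aA].
    by rewrite [RHS]big_enum_val; apply: eq_bigr => a _; rewrite !mxE.
  have aE : a \notin E by apply: contra aA; exact: (fintype.subsetP EA).
  by rewrite wE // mul0r.
move=> a; have [aA|aA] := boolP (a \in A); last first.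
  by apply: wE; apply: contra aA; exact: (fintype.subsetP EA).
have /rowP/(_ (enum_rank_in aA a)) : u = 0.
  by apply/eqP; rewrite -(mulmx_free_eq0 _ freeJ) uJ.
by rewrite !mxE enum_rankK_in.
Qed.

End AlgebraicIndependence.

(** * Ranks, minors and positive semidefinite matrices *)

Section RankMinors.

Variable K : fieldType.

Lemma injective_sort k d (f : 'I_k -> 'I_d) : injective f ->
  exists (h : 'I_k -> 'I_d) (s : 'S_k),
    {homo h : i j / (i < j)%N} /\ f =1 h \o s.
Proof.
move=> f_inj; pose A : {pred 'I_d} := mem (codom f).
have cA : #|A| = k by rewrite card_codom // card_ord.
pose h (i : 'I_k) : 'I_d := Order.enum_val (cast_ord (esym cA) i).
have h_lt : {homo h : i j / (i < j)%N}.
  move=> i j ij; have : (h i < h j)%O; last by [].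
  by rewrite (leW_mono (Order.le_enum_val (@le_total _ _) (A := A))).
have fA i : f i \in A by exact: codom_f.
pose s i := cast_ord cA (Order.enum_rank_in (fA i) (f i)).
have hs i : h (s i) = f i.
  by rewrite /h /s cast_ordK Order.enum_rankK_in.
have s_inj : injective s by move=> i j e; apply: f_inj; rewrite -!hs e.
by exists h, (perm s_inj); split=> // i; rewrite /= permE hs.
Qed.

(** A matrix of rank greater than r has a nonzero minor of size r + 1; sorting the
    selected rows and columns only changes its sign. *)
Lemma rank_le_minors r d (M : 'M[K]_d) :
  (forall p, minors r.+1 M p -> p = 0) -> (\rank M <= r)%N.
Proof.
move=> M0; rewrite leqNgt; apply/negP => ltr.
pose f0 := maxrankfun M; pose f i := f0 (widen_ord ltr i).
have f_inj : injective f by move=> i j /maxrankfun_inj [] /val_inj.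
have freeN : row_free (rowsub f M).
  have /row_freeP[B MB] := maxrowsub_free M.
  apply/row_freeP; exists (colsub (widen_ord ltr) B).
  rewrite [rowsub f M](rowsub_comp _ (widen_ord ltr)) -mxsub_mul MB.
  by apply/matrixP => i j; rewrite !mxE.
have fullNT : row_full (rowsub f M)^T by rewrite /row_full mxrank_tr.
pose g i := fullrankfun fullNT i.
have g_inj : injective g by exact: fullrankfun_inj.
have Hdet : \det (mxsub f g M) != 0.
  rewrite -det_tr trmx_mxsub -unitfE -unitmxE.
  have -> : mxsub g f M^T = rowsub (fullrankfun fullNT) (rowsub f M)^T.
    by apply/matrixP => i j; rewrite !mxE.
  exact: fullrowsub_unit.
have [f' [s [f'_lt fE]]] := injective_sort f_inj.
have [g' [t [g'_lt gE]]] := injective_sort g_inj.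
move: Hdet; have -> : mxsub f g M = perm_mx s *m mxsub f' g' M *m perm_mx t^-1.
  rewrite -row_permE -col_permE; apply/matrixP => i j; rewrite !mxE.
  by rewrite fE gE.
rewrite !det_mulmx (M0 (\det (mxsub f' g' M))) ?mulr0 ?mul0r ?eqxx //.
by exists f', g'.
Qed.

(** A symmetric matrix of rank [s] is congruent to a matrix of size [s] padded
    with zeros; halving that matrix makes the middle factor a sum N + N^T. *)
Lemma symmetric_rank_le r d (S : 'M[K]_d) : 2 != 0 :> K -> S^T = S ->
  (\rank S <= r)%N ->
  exists (B : 'M[K]_(r, d)) (N : 'M[K]_r), S = B^T *m (N + N^T) *m B.
Proof.
move=> two sS rS.
have [k [C [B0 [B' [kr BB' SC]]]]] : exists k (C : 'M[K]_(d, k)) (B0 : 'M[K]_(k, d)) B',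
    [/\ (k <= r)%N, B0 *m B' = 1%:M & S = C *m B0].
  have /row_freeP[B' BB'] := row_base_free S.
  by exists (\rank S), (col_base S), (row_base S), B'; rewrite mulmx_base.
have SB : S *m B' *m B0 = S by rewrite {1}SC -!mulmxA (mulmxA B0) BB' mul1mx.
pose M : 'M[K]_k := B'^T *m S *m B'.
have sM : M^T = M by rewrite /M !trmx_mul trmxK sS mulmxA.
have SM : S = B0^T *m M *m B0.
  have SB2 : S *m (B' *m B0) = S by rewrite mulmxA.
  by rewrite /M -!mulmxA SB2 mulmxA -trmx_mul -[in RHS]sS -trmx_mul SB2 sS.
pose P : 'M[K]_(r, k) := pid_mx k; pose PT : 'M[K]_(k, r) := pid_mx k.
have PTP : PT *m P = 1%:M by rewrite /PT /P pid_mx_id // pid_mx_1.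
clearbody M P PT.
exists (P *m B0), (PT^T *m (2^-1 *: M) *m PT).
have -> : PT^T *m (2^-1 *: M) *m PT + (PT^T *m (2^-1 *: M) *m PT)^T = PT^T *m M *m PT.
  rewrite !trmx_mul trmxK [(_ *: M)^T]linearZ /= sM mulmxA -mulmxDl -mulmxDr -scalerDl.
  have -> : 2^-1 + 2^-1 = 1 :> K by field.
  by rewrite scale1r.
rewrite trmx_mul -!mulmxA (mulmxA PT P) PTP mul1mx (mulmxA P^T) -trmx_mul PTP.
by rewrite trmx1 mul1mx mulmxA.
Qed.

End RankMinors.

Section PositiveSemidefinite.

Variable R : realType.

Definition qform d (S : 'M[R]_d) (v : 'cV[R]_d) : R := (v^T *m S *m v) 0 0.

Lemma qform_sum d (S : 'M[R]_d) v : qform S v = \sum_i \sum_j S i j * (v i 0 * v j 0).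
Proof.
rewrite /qform mxE exchange_big /=; apply: eq_bigr => j _; rewrite mxE mulr_suml.
by apply: eq_bigr => i _; rewrite !mxE; ring.
Qed.

Lemma tr_mul_self_ge0 d (u : 'cV[R]_d) : 0 <= (u^T *m u) 0 0.
Proof. by rewrite mxE sumr_ge0 // => i _; rewrite !mxE -expr2 sqr_ge0. Qed.

Lemma tr_mul_self_eq0 d (u : 'cV[R]_d) : (u^T *m u) 0 0 = 0 -> u = 0.
Proof.
rewrite mxE => /eqP; rewrite psumr_eq0 => [/allP h|i _]; last first.
  by rewrite !mxE -expr2 sqr_ge0.
apply/colP => i; have := h i (mem_index_enum _).
by rewrite !mxE /= -expr2 sqrf_eq0 => /eqP.
Qed.

Lemma mx11_tr (A : 'M[R]_1) : A^T 0 0 = A 0 0. Proof. by rewrite mxE. Qed.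

Lemma mx11M (A B : 'M[R]_1) : (A *m B) 0 0 = A 0 0 * B 0 0.
Proof. by rewrite mxE big_ord1. Qed.

Lemma mx11D (A B : 'M[R]_1) : (A + B) 0 0 = A 0 0 + B 0 0.
Proof. by rewrite mxE. Qed.

Lemma mx11N (A : 'M[R]_1) : (- A) 0 0 = - A 0 0.
Proof. by rewrite mxE. Qed.

Lemma mx11Z a (A : 'M[R]_1) : (a *: A) 0 0 = a * A 0 0.
Proof. by rewrite mxE. Qed.

Definition mx11E := (mx11D, mx11N, mx11Z).

Lemma qformD d (S : 'M[R]_d) t u v : S^T = S ->
  qform S (u + t *: v) = qform S u + 2 * t * (u^T *m S *m v) 0 0 + t ^+ 2 * qform S v.
Proof.
move=> sS; rewrite /qform [(_ + _)^T]linearD /= [(_ *: _)^T]linearZ /= !(mulmxDl, mulmxDr).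
rewrite -!scalemxAl -!scalemxAr !mx11E.
have -> : (v^T *m S *m u) 0 0 = (u^T *m S *m v) 0 0.
  by rewrite -[LHS]mx11_tr !trmx_mul trmxK sS mulmxA.
ring.
Qed.

(** Moving from S v in the direction - v changes the form at the constant rate
    - 2 |S v|^2, which would make it negative. *)
Lemma psd_radical d (S : 'M[R]_d) v : psd S -> qform S v = 0 -> S *m v = 0.
Proof.
move=> [sS S0] v0; apply: tr_mul_self_eq0; set u := S *m v.
apply/eqP; rewrite eq_le tr_mul_self_ge0 andbT leNgt; apply/negP => a0.
set a := (u^T *m u) 0 0 in a0 *.
have := S0 (u + (- (qform S u + 1) / (2 * a)) *: v).
rewrite -/(qform _ _) qformD // v0 mulr0 addr0 -mulmxA -/u -/a leNgt => /negP; apply.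
have -> : 2 * (- (qform S u + 1) / (2 * a)) * a = - (qform S u + 1).
  by field; rewrite gt_eqF.
by rewrite opprD addrA subrr add0r oppr_lt0 ltr01.
Qed.

Lemma psd_diag0 d (S : 'M[R]_d) : psd S -> (forall i, S i i = 0) -> S = 0.
Proof.
move=> pS S0; apply/matrixP => i j; rewrite mxE.
have : S *m delta_mx j 0 = 0 :> 'cV_d.
  apply: psd_radical => //; rewrite /qform trmx_delta -rowE -colE.
  by rewrite !mxE.
by move/colP/(_ i); rewrite -colE !mxE.
Qed.

(** Cholesky elimination: subtracting the square of a column normalized at a
    nonzero diagonal entry keeps the form positive semidefinite and lowers
    the rank. *)
Lemma psd_factor n d (S : 'M[R]_d) : psd S -> (\rank S <= n)%N ->
  exists X : 'M[R]_(d, n), S = X *m X^T.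
Proof.
elim: n S => [|n IH] S pS.
  rewrite leqn0 mxrank_eq0 => /eqP->; exists 0; by rewrite mul0mx.
move=> rS; have [Sd0|] := pselect (forall i, S i i = 0).
  by exists 0; rewrite mul0mx; exact: psd_diag0.
move=> /existsNP[i /eqP Si0]; have [sS S0] := pS.
pose e : 'cV[R]_d := delta_mx i 0; pose a := S i i.
have qe : qform S e = a by rewrite /qform trmx_delta -rowE -colE !mxE.
have a0 : 0 < a by rewrite lt_neqAle eq_sym Si0 -qe; exact: S0.
pose x : 'cV[R]_d := (Num.sqrt a)^-1 *: (S *m e).
have xx : x *m x^T = a^-1 *: (S *m e *m (S *m e)^T).
  rewrite /x linearZ /= -scalemxAl -scalemxAr scalerA -invfM -expr2 sqr_sqrtr //.
  exact: ltW.
pose S' := S - x *m x^T.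
have S'e : S' *m e = 0.
  have ea : (S *m e)^T *m e = a%:M.
    by rewrite trmx_mul sS [LHS]mx11_scalar -/(qform _ _) qe.
  rewrite mulmxBl xx -scalemxAl -(mulmxA (S *m e)) ea.
  by rewrite mul_mx_scalar scalerA mulVf ?gt_eqF // scale1r subrr.
have sS' : S'^T = S' by rewrite linearB /= trmx_mul trmxK sS.
have pS' : psd S'.
  split=> // v; pose c := (v^T *m S *m e) 0 0.
  suff -> : (v^T *m S' *m v) 0 0 = qform S (v + (- c / a) *: e) by exact: S0.
  rewrite qformD // qe -/c mulmxBr mulmxBl xx -scalemxAr -scalemxAl !mx11E.
  rewrite -/(qform _ _).
  have -> : (v^T *m (S *m e *m (S *m e)^T) *m v) 0 0 = c * c.
    rewrite !mulmxA -mulmxA mx11M; congr (_ * _).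
    by rewrite -mx11_tr trmx_mul trmxK mulmxA.
  by field; rewrite gt_eqF.
have S'S : (S' <= S)%MS.
  rewrite /S' xx trmx_mul sS addmx_sub // eqmx_opp scalemx_sub //.
  by rewrite mulmxA submxMl.
have ltr : (\rank S' < \rank S)%N.
  rewrite ltn_neqAle (mxrankS S'S) andbT; apply: contraTneq a0 => eqr.
  have /submxP[Z SZ] : (S <= S')%MS by rewrite -(geq_leqif (mxrank_leqif_sup S'S)) eqr.
  by rewrite -qe /qform -mulmxA SZ -mulmxA S'e !mulmx0 mxE ltxx.
have [X' S'X'] := IH S' pS' (leq_trans ltr rS).
exists (row_mx x X' : 'M_(d, 1 + n)).
rewrite [X in _ = _ *m X](tr_row_mx x X').
by rewrite [RHS](mul_row_col x X') -S'X' /S' addrC subrK.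
Qed.

(** The reflection exchanging [b] with its length times the first basis vector. *)
Lemma householder r (b : 'rV[R]_(1 + r)) :
  exists2 Q : 'M[R]_(1 + r), Q *m Q^T = 1%:M & rsubmx (b *m Q) = 0.
Proof.
pose c := Num.sqrt ((b *m b^T) 0 0); pose e : 'rV[R]_(1 + r) := row_mx 1%:M 0.
have bb0 : 0 <= (b *m b^T) 0 0.
  by have := tr_mul_self_ge0 b^T; rewrite trmxK.
have c2 : c * c = (b *m b^T) 0 0 by rewrite -expr2 sqr_sqrtr.
have rce : rsubmx (c *: e) = 0 by rewrite linearZ /= row_mxKr scaler0.
pose v := b - c *: e; pose n2 := (v *m v^T) 0 0.
have [n20|n20] := eqVneq n2 0.
  have v0 : v = 0.
    by apply: trmx_inj; rewrite trmx0; apply: tr_mul_self_eq0; rewrite trmxK.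
  exists 1%:M; rewrite ?trmx1 mulmx1 // -rce; congr rsubmx.
  by apply/eqP; rewrite -subr_eq0; apply/eqP.
have vv : v *m v^T = n2%:M by rewrite [LHS]mx11_scalar.
pose W := v^T *m v; pose a := 2 / n2; pose Q := 1%:M - a *: W.
have QT : Q^T = Q by rewrite linearB /= linearZ /= trmx1 trmx_mul trmxK.
exists Q.
  have WW : W *m W = n2 *: W.
    by rewrite /W mulmxA -(mulmxA v^T) vv mul_mx_scalar -scalemxAl.
  have aan : a * a * n2 = a + a by rewrite /a; field.
  rewrite QT {1}/Q mulmxBl mul1mx -scalemxAl /Q mulmxBr mulmx1 -scalemxAr WW.
  by rewrite scalerBr !scalerA aan scalerDl opprB addrK subrK.
have bv : 2 * (b *m v^T) 0 0 = n2.
  have eb : (e *m b^T) 0 0 = (b *m e^T) 0 0.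
    by rewrite -mx11_tr trmx_mul trmxK.
  have ee : (e *m e^T) 0 0 = 1.
    by rewrite /e tr_row_mx mul_row_col trmx1 mulmx1 mul0mx addr0 mxE eqxx.
  have -> : n2 = (b *m b^T) 0 0 - 2 * c * (b *m e^T) 0 0 + c * c * (e *m e^T) 0 0.
    rewrite /n2 /v [(_ - _)^T]linearB /= [(_ *: _)^T]linearZ /= !(mulmxBl, mulmxBr).
    rewrite -!scalemxAl -!scalemxAr.
    by rewrite !(eb, mx11E); ring.
  rewrite /v [(_ - _)^T]linearB /= [(_ *: _)^T]linearZ /= mulmxBr -scalemxAr ee !mx11E -c2; ring.
have -> : b *m Q = c *: e.
  rewrite /Q /W mulmxBr mulmx1 -scalemxAr mulmxA [b *m v^T]mx11_scalar mul_scalar_mx.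
  rewrite scalerA /a mulrAC bv divff // scale1r.
  by rewrite /v opprB addrC subrK.
exact: rce.
Qed.

(** Every Gram matrix has a lower trapezoidal factor: rotate the rows of the
    factor so that the first one lies on the first axis, and iterate. *)
Lemma trapezoidal_factor r d (X : 'M[R]_(d, r)) :
  exists2 Y : 'M[R]_(d, r), Y *m Y^T = X *m X^T
    & forall (i : 'I_d) (l : 'I_r), (i < l)%N -> Y i l = 0.
Proof.
elim: r d X => [|r IH] d X; first by exists X => // i [].
case: d X => [|d] X; first by exists X => // -[].
have [Q QQ bQ] := @householder r (usubmx (X : 'M_(1 + d, 1 + r))).
pose X1 : 'M[R]_(1 + d, 1 + r) := X *m Q.
have XX : X *m X^T = X1 *m X1^T.
  by rewrite /X1 trmx_mul mulmxA -[X *m Q *m _]mulmxA QQ mulmx1.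
have X1ur : ursubmx X1 = 0.
  by rewrite /ursubmx /X1 -mul_usub_mx bQ.
have [Y' YY' Y'0] := IH d (drsubmx X1).
pose Y : 'M[R]_(1 + d, 1 + r) := block_mx (ulsubmx X1) 0 (dlsubmx X1) Y'.
have YY : Y *m Y^T = X1 *m X1^T.
  rewrite -[X1]submxK X1ur /Y !tr_block_mx !mulmx_block YY'.
  by rewrite !trmx0 !mulmx0 !mul0mx.
suff Y0 (i : 'I_(1 + d)) (l : 'I_(1 + r)) : (i < l)%N -> Y i l = 0.
  by exists Y; [rewrite XX|exact: Y0].
case: (split_ordP i) => i' ->; case: (split_ordP l) => l' ->;
  rewrite /Y ?block_mxEul ?block_mxEur ?block_mxEdl ?block_mxEdr //=.
- by rewrite (ord1 i') (ord1 l').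
- by move=> _; rewrite mxE.
- by rewrite (ord1 l').
by rewrite ltn_add2l; exact: Y'0.
Qed.

(** A crude bound, used to make quadratic forms positive by adding a multiple of
    the identity and to see that positive definiteness is an open condition. *)
Lemma qform_bound d (B : 'M[R]_d) v :
  `|qform B v| <= (\sum_i \sum_j `|B i j|) * (v^T *m v) 0 0.
Proof.
rewrite qform_sum (le_trans (ler_norm_sum _ _ _)) // mulr_suml ler_sum // => i _.
rewrite (le_trans (ler_norm_sum _ _ _)) // mulr_suml ler_sum // => j _.
rewrite normrM ler_wpM2l //.
have vi k : v k 0 ^+ 2 <= (v^T *m v) 0 0.
  rewrite mxE (bigD1 k) //= !mxE -expr2 lerDl sumr_ge0 // => l _.
  by rewrite !mxE -expr2 sqr_ge0.
by rewrite ler_norml; have := vi i; have := vi j; nra.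
Qed.

End PositiveSemidefinite.

(** * Polynomial identities between squared distances *)

Section PolynomialIdentities.

Variables (R : realFieldType) (n : nat).
Implicit Types (p : {mpoly R[n]}) (v u : 'I_n -> R).

Definition on_line v u p : {poly R} := mmap polyC (fun j => (v j)%:P + u j *: 'X) p.

Lemma horner_on_line v u p t : (on_line v u p).[t] = p.@[fun j => v j + t * u j].
Proof.
rewrite /on_line; elim/mpoly_ring_ind: p => [c|i|p q hp hq|p q hp hq].
- by rewrite mmapC hornerC mevalC.
- by rewrite mmapX mmap1U mevalXU !hornerE mulrC.
- by rewrite mmapD hornerD hp hq mevalD.
- by rewrite rmorphM hornerM hp hq mevalM.
Qed.

Lemma deriv_on_line v u p :
  (on_line v u p)^`() = \sum_j u j *: on_line v u p^`M(j).
Proof.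
rewrite /on_line; elim/mpoly_ring_ind: p => [c|i|p q hp hq|p q hp hq].
- rewrite mmapC derivC big1 // => j _.
  by rewrite mderivC mmap0 scaler0.
- rewrite mmapX mmap1U derivD derivC derivZ derivX add0r (bigD1 i) //=.
  rewrite big1 ?addr0 => [|j ji].
    by rewrite mderiv_var eqxx rmorph1.
  by rewrite mderiv_var eq_sym (negbTE ji) mmap0 scaler0.
- rewrite mmapD derivD hp hq -big_split; apply: eq_bigr => j _.
  by rewrite mderivD mmapD scalerDr.
- rewrite rmorphM derivM hp hq mulr_suml mulr_sumr -big_split /=.
  apply: eq_bigr => j _.
  by rewrite mderivM mmapD !rmorphM /= scalerDr scalerAl scalerAr.
Qed.

(** Used with a line in the space of matrices: a large multiple of the identity
    makes any symmetric matrix positive semidefinite, so only a ray of parameters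
    is available. *)
Lemma poly_vanish_ray (q : {poly R}) t0 : (forall t, t0 <= t -> q.[t] = 0) -> q = 0.
Proof.
move=> q0; apply: (@roots_geq_poly_eq0 _ q [seq t0 + i%:R | i <- iota 0 (size q)]).
- apply/allP => _ /mapP[i _ ->]; apply/rootP; apply: q0.
  by rewrite lerDl ler0n.
- rewrite map_inj_uniq ?iota_uniq // => i j /addrI /eqP.
  by rewrite eqr_nat => /eqP.
- by rewrite size_map size_iota.
Qed.

Lemma mpoly_deriv0_const p : (forall i, p^`M(i) = 0) -> p = (p@_0)%:MP.
Proof.
move=> d0; apply/mpolyP => m; rewrite mcoeffC; have [->|m0] := eqVneq m 0%MM.
  by rewrite mulr1.
rewrite mulr0; have [i mi] : exists i, m i != 0%N.
  apply: contrapT => h; move/eqP: m0; apply; apply/mnmP => i; rewrite mnm0E.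
  by apply/eqP; apply: contrapT => /negP mi; apply: h; exists i.
have := mcoeff_deriv i (m - U_(i))%MM p; rewrite d0 mcoeff0 submK; last first.
  by apply/mnm_lepP => l; rewrite mnm1E; case: eqP => // <-; rewrite lt0n.
by move/esym/eqP; rewrite mulrn_eq0 => /eqP.
Qed.

Lemma mpoly_vanish p : (forall v, p.@[v] = 0) -> p = 0.
Proof.
elim: (msize p) {-2}p (leqnn (msize p)) => {p} [|b IH] p pb p0.
  by apply/eqP; rewrite -msize_poly_eq0 -leqn0.
have d0 i : p^`M(i) = 0.
  have [//|nz] := eqVneq p^`M(i) 0.
  apply: IH => [|v]; first by rewrite -ltnS (leq_trans (msize_deriv nz)).
  pose u j : R := (j == i)%:R.
  have l0 : on_line v u p = 0.
    by apply: (@poly_vanish_ray _ 0) => t _; rewrite horner_on_line p0.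
  have := deriv_on_line v u p; rewrite l0 deriv0 => /(congr1 (horner^~ 0)).
  rewrite hornerC (bigD1 i) //= big1 ?addr0 => [|j /negbTE ji]; last first.
    by rewrite /u ji scale0r.
  rewrite /u eqxx scale1r horner_on_line => e; rewrite [RHS]e.
  by apply: meval_eq => j; rewrite mul0r addr0.
by have := p0 (fun=> 0); rewrite (mpoly_deriv0_const d0) mevalC => ->; rewrite mpolyC0.
Qed.

End PolynomialIdentities.

Section SquaredDistances.

(** The quadratic form of [S] at the difference of two standard basis vectors;
    for symmetric [S] this is the entry of the variogram matrix of [S]. *)
Definition sqdist (T : zmodType) d (S : 'M[T]_d) (i j : 'I_d) : T :=
  S i i + S j j - S i j - S j i.

Lemma sqdistC (T : comNzRingType) d (S : 'M[T]_d) i j : sqdist S i j = sqdist S j i.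
Proof. by rewrite /sqdist; ring. Qed.

Lemma map_sqdist (T T' : nzRingType) (f : {rmorphism T -> T'}) d (S : 'M[T]_d) i j :
  f (sqdist S i j) = sqdist (map_mx f S) i j.
Proof. by rewrite /sqdist !rmorphB rmorphD !mxE. Qed.

Lemma sqdistE (T : comNzRingType) d (S : 'M[T]_d) i j :
  sqdist S i j = ((delta_mx 0 i - delta_mx 0 j : 'rV_d) *m S
                  *m (delta_mx i 0 - delta_mx j 0 : 'cV_d)) 0 0.
Proof.
rewrite mulmxBl !mulmxBr -!rowE -!colE !mxE /sqdist; ring.
Qed.

(** Polynomial identities between the squared distances of [d] points in a real
    space of dimension [r] hold for symmetric matrices of rank at most [r] over
    any extension field: the congruence normal form B^T (N + N^T) B is polynomial in B and
    N, and adding a large multiple of the identity to N makes it a Gram matrix. *)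
Lemma gram_identity_transfer (R : realType) (K : fieldType) (iota : {rmorphism R -> K})
    d r n (e1 e2 : 'I_n -> 'I_d) (p : {mpoly R[n]}) :
  (forall X : 'M[R]_(d, r), p.@[fun k => sqdist (X *m X^T) (e1 k) (e2 k)] = 0) ->
  forall S : 'M[K]_d, S^T = S -> (\rank S <= r)%N ->
  mmap iota (fun k => sqdist S (e1 k) (e2 k)) p = 0.
Proof.
move=> p0 S sS rS.
have two : 2 != 0 :> K by rewrite -(rmorph_nat iota) fmorph_eq0 pnatr_eq0.
have [B [N ->]] := symmetric_rank_le two sS rS.
pose T : finType := ('I_r * 'I_d + 'I_r * 'I_r)%type.
pose A := {mpoly R[#|{: T}|]}.
pose BX : 'M[A]_(r, d) := \matrix_(i, j) 'X_(enum_rank (inl (i, j) : T)).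
pose NX : 'M[A]_r := \matrix_(i, j) 'X_(enum_rank (inr (i, j) : T)).
pose SX := BX^T *m (NX + NX^T) *m BX.
pose q : A := msubst (fun k => sqdist SX (e1 k) (e2 k)) p.
have map_SX (T' : comNzRingType) (phi : {rmorphism A -> T'}) :
    map_mx phi SX = (map_mx phi BX)^T *m
      (map_mx phi NX + (map_mx phi NX)^T) *m map_mx phi BX.
  by rewrite !map_mxM map_mxD !map_trmx.
(* [q] is the relation evaluated at the generic matrix of rank at most r. *)
suff q0 : q = 0.
  pose w (k : 'I_#|{: T}|) : K :=
    match enum_val k with inl ij => B ij.1 ij.2 | inr ij => N ij.1 ij.2 end.
  pose phi : {rmorphism A -> K} := mmap iota w.
  have <- : map_mx phi BX = B.
    by apply/matrixP => i j; rewrite !mxE /= mmapX mmap1U /w enum_rankK.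
  have <- : map_mx phi NX = N.
    by apply/matrixP => i j; rewrite !mxE /= mmapX mmap1U /w enum_rankK.
  rewrite -map_SX -[RHS](rmorph0 phi) -q0 /q /msubst rmorph_mmap /mmap.
  apply: eq_bigr => m _; congr (_ * _); first by rewrite /= mmapC.
  by apply: mmap1_eq => k; rewrite [RHS]map_sqdist.
apply: mpoly_vanish => v.
pose B1 : 'M[R]_(r, d) := \matrix_(i, j) v (enum_rank (inl (i, j) : T)).
pose N1 : 'M[R]_r := \matrix_(i, j) v (enum_rank (inr (i, j) : T)).
pose u (k : 'I_#|{: T}|) : R :=
  match enum_val k with inl _ => 0 | inr ij => (ij.1 == ij.2)%:R end.
(* Along this line the identity is added to [N1], with coefficient t. *)
suff l0 : on_line v u q = 0.
  have := horner_on_line v u q 0; rewrite l0 hornerC => e; rewrite [RHS]e.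
  by apply: meval_eq => k; rewrite mul0r addr0.
apply: (@poly_vanish_ray _ _ (\sum_i \sum_j `|N1 i j|)) => t tN.
rewrite horner_on_line /q meval_msubst.
pose N2 := N1 + t%:M.
have psdN : psd (N2 + N2^T).
  split=> [|x]; first by rewrite linearD /= trmxK addrC.
  have -> : (x^T *m (N2 + N2^T) *m x) 0 0 = 2 * qform N2 x.
    rewrite mulmxDr mulmxDl mx11D /qform -[X in _ + X]mx11_tr !trmx_mul !trmxK mulmxA.
    ring.
  rewrite mulr_ge0 // /qform /N2 mulmxDr mulmxDl mx11D mul_mx_scalar -scalemxAl mx11Z.
  have := qform_bound N1 x; rewrite ler_norml => /andP[+ _].
  rewrite -subr_ge0 opprK => /le_trans; apply; rewrite lerD2l.
  by rewrite ler_wpM2r // tr_mul_self_ge0.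
have [W NW] := psd_factor psdN (rank_leq_row _).
rewrite -[RHS](p0 (B1^T *m W)); apply: meval_eq => k.
rewrite [LHS]map_sqdist; congr sqdist; rewrite map_SX.
have -> : map_mx (meval (fun j => v j + t * u j)) BX = B1.
  by apply/matrixP => i j; rewrite !mxE mevalXU /u enum_rankK mulr0 addr0.
have -> : map_mx (meval (fun j => v j + t * u j)) NX = N2.
  by apply/matrixP => i j; rewrite !mxE mevalXU /u enum_rankK mulr_natr.
by rewrite NW trmx_mul trmxK !mulmxA.
Qed.

End SquaredDistances.

(** * Algebraic independence of the squared edge lengths *)

Section EdgeDistances.

Variable d : nat.
Notation n := #|{: Defs.lt_pair d}|.

Definition fst_end (k : 'I_n) : 'I_d := (val (enum_val k)).1.
Definition snd_end (k : 'I_n) : 'I_d := (val (enum_val k)).2.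

Definition edge_set (e : rel 'I_d) : {set 'I_n} :=
  finset (fun k => e (fst_end k) (snd_end k)).

Lemma ends_lt k : (fst_end k < snd_end k)%N.
Proof. exact: (valP (enum_val k)). Qed.

Lemma endsP (i j : 'I_d) : i != j ->
  exists k, fst_end k = i /\ snd_end k = j \/ fst_end k = j /\ snd_end k = i.
Proof.
have H (a b : 'I_d) : (a < b)%N -> exists k, fst_end k = a /\ snd_end k = b.
  move=> ab; exists (enum_rank (exist _ (a, b) ab : Defs.lt_pair d)).
  by rewrite /fst_end /snd_end enum_rankK.
rewrite neq_ltn => /orP[] /H[k hk]; exists k; [left|right]; tauto.
Qed.

Lemma edge_subringE (C : fieldType) (e : rel 'I_d) (p : gamma_ring C d) :
  edge_subring e p <-> vars_in (edge_set e) p.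
Proof.
split=> h m mp.
  by move=> k; rewrite inE /fst_end => /(h m mp); rewrite enum_valK.
by move=> k ek; apply: h mp _ _; rewrite inE /fst_end /snd_end enum_rankK.
Qed.

Section Generic.

Variable C : fieldType.

Lemma generic_GammaE k :
  generic_Gamma C d (fst_end k) (snd_end k) = 'X_k.
Proof.
rewrite mxE /sort_pair ltnW ?ends_lt // insubT /=; first exact: ends_lt.
move=> h; congr 'X_(_); rewrite -[RHS]enum_valK; congr enum_rank.
by apply: val_inj; rewrite /= -surjective_pairing.
Qed.

Lemma sort_pairC (i j : 'I_d) : sort_pair i j = sort_pair j i.
Proof.
rewrite /sort_pair; case: ltngtP => // ij; have -> // : i = j; exact: val_inj.
Qed.

Lemma generic_Gamma_sym : (generic_Gamma C d)^T = generic_Gamma C d.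
Proof. by apply/matrixP => i j; rewrite !mxE sort_pairC. Qed.

Lemma generic_Gamma_diag i : generic_Gamma C d i i = 0.
Proof. by rewrite mxE /sort_pair leqnn insubF //= ltnn. Qed.

Lemma centering_sym : (centering C d)^T = centering C d.
Proof. by rewrite linearB /= linearZ /= trmx1 trmx_const. Qed.

Lemma subst_sigma_morph : exists phi : {rmorphism sigma_ring C d -> gamma_ring C d},
  phi =1 @subst_sigma C d.
Proof. by exists (comp_mpoly [tuple sigma_of_Gamma C d (val (enum_val i)).1
  (val (enum_val i)).2 | i < #|{: Defs.le_pair d}|]). Qed.

Lemma sigma_of_Gamma_sym : (sigma_of_Gamma C d)^T = sigma_of_Gamma C d.
Proof.
rewrite /sigma_of_Gamma !trmx_mul map_trmx centering_sym linearZ /=.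
by rewrite generic_Gamma_sym mulmxA.
Qed.

Lemma subst_generic_Sigma (phi : {rmorphism sigma_ring C d -> gamma_ring C d}) :
  phi =1 @subst_sigma C d -> map_mx phi (generic_Sigma C d) = sigma_of_Gamma C d.
Proof.
move=> phiE; apply/matrixP => i j; rewrite mxE phiE.
wlog ij : i j / (i <= j)%N.
  move=> H; case: (leqP i j) => [|/ltnW] ij; first exact: H.
  rewrite -[in RHS]sigma_of_Gamma_sym [RHS]mxE -H //.
  by congr subst_sigma; rewrite !mxE sort_pairC.
rewrite mxE /sort_pair ij insubT /subst_sigma comp_mpolyXU -tnth_nth tnth_mktuple.
by rewrite enum_rankK.
Qed.

Lemma minors_in_ideal_J r p : minors r.+1 (sigma_of_Gamma C d) p -> ideal_J r p.
Proof.
move=> [f [g [hf hg ->]]]; apply: ideal_gen_sub.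
have [phi phiE] := subst_sigma_morph.
exists (\det (mxsub f g (generic_Sigma C d))).
  by apply: ideal_gen_sub; exists f, g.
by rewrite -phiE -det_map_mx map_mxsub subst_generic_Sigma.
Qed.

(** gamma inverts sigma: the difference of two standard basis vectors is fixed by
    the centering projection, so only the form of -Gamma/2 remains. *)
Lemma sqdist_sigma (T : comNzRingType) (rho : {rmorphism gamma_ring C d -> T}) i j :
  (2 != 0 :> C) -> (d%:R != 0 :> C) ->
  sqdist (map_mx rho (sigma_of_Gamma C d)) i j = rho (generic_Gamma C d i j).
Proof.
move=> two d0; rewrite -map_sqdist; congr (rho _).
rewrite sqdistE /sigma_of_Gamma.
set P := map_mx _ _; set b := (_ - _ : 'rV_d); set c := (_ - _ : 'cV_d).
have PE : P = 1%:M - (d%:R^-1 : C)%:MP *: const_mx 1.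
  by apply/matrixP => a a'; rewrite !mxE rmorphB rmorphM /= rmorph_nat mulr1.
have bP : b *m P = b.
  rewrite PE mulmxBr mulmx1 -scalemxAr.
  have -> : b *m const_mx 1 = 0 :> 'M_(1, d).
    apply/rowP => a; rewrite mulmxBl -!rowE !mxE subrr //.
  by rewrite scaler0 subr0.
have Pc : P *m c = c.
  rewrite PE mulmxBl mul1mx -scalemxAl.
  have -> : const_mx 1 *m c = 0 :> 'M_(d, 1).
    by apply/colP => a; rewrite mulmxBr -!colE !mxE subrr.
  by rewrite scaler0 subr0.
rewrite !mulmxA bP -mulmxA Pc -scalemxAr -scalemxAl mxE -sqdistE /sqdist.
have -> : generic_Gamma C d j i = generic_Gamma C d i j.
  by rewrite -[in LHS]generic_Gamma_sym mxE.
rewrite !generic_Gamma_diag; set G := generic_Gamma C d i j; set h := _%:MP.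
have h2 : h * - 2%:R = 1.
  rewrite -(rmorph_nat (@mpolyC #|{: Defs.lt_pair d}| C)) -rmorphN -rmorphM mulrNN.
  by rewrite mulVf // rmorph1.
by rewrite -[RHS]mul1r -h2; ring.
Qed.

End Generic.

(** A nonzero relation between the squared distances of the edges would, over the
    residue field of a prime ideal containing [ideal_J] but no nonzero element of
    the edge subring, be a relation between algebraically independent elements. *)
Lemma edge_distances_independent (R : realType) (r : nat) (e : rel 'I_d) :
  @ideal_JG R[i] d e r = [set 0] ->
  forall p : {mpoly R[n]}, vars_in (edge_set e) p ->
  (forall X : 'M[R]_(d, r), p.@[fun k => sqdist (X *m X^T) (fst_end k) (snd_end k)] = 0) ->
  p = 0.
Proof.
move=> hJ p pE p0; pose C : fieldType := R[i]; pose A := gamma_ring C d.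
pose S : set A := [set q | edge_subring e q /\ q <> 0].
have [d0|d0] := eqVneq d 0%N.
  have card0 : n = 0%N.
    apply: eq_card0 => -[[i j] hij]; exfalso.
    by have := ltn_ord i; rewrite [X in (_ < X)%N]d0.
  apply: mpoly_vanish => v; rewrite -[RHS](p0 0); apply: meval_eq => k; exfalso.
  by move: k => [k hk]; rewrite card0 in hk.
have [||||I [idI prI JI IS]] := @exists_prime_avoiding A (@ideal_J C d r) S.
- exact: is_ideal_gen.
- split; last exact/eqP/oner_neq0.
  by rewrite edge_subringE -mpolyC1; exact: vars_inC.
- move=> x y [/edge_subringE xE /eqP x0] [/edge_subringE yE /eqP y0]; split.
    by apply/edge_subringE/vars_inM.
  by apply/eqP/mulf_neq0.
- move=> x Jx [xE]; apply.
  by have : @ideal_JG C d e r x by []; rewrite [ideal_JG _ _]hJ.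
have [K [rho rhoI]] := exists_residue_field idI prI.
pose Sb : 'M[K]_d := map_mx rho (sigma_of_Gamma C d).
have sSb : Sb^T = Sb by rewrite map_trmx sigma_of_Gamma_sym.
have rSb : (\rank Sb <= r)%N.
  apply: rank_le_minors => _ [f [g [hf hg ->]]].
  rewrite -map_mxsub det_map_mx; apply/rhoI/JI/minors_in_ideal_J.
  by exists f, g.
pose iota : {rmorphism R -> K} := rho \o (@mpolyC n C) \o (@real_complex R).
have := @gram_identity_transfer R K iota d r n fst_end snd_end p p0 Sb sSb rSb.
have two : 2 != 0 :> C by rewrite pnatr_eq0.
have dC : d%:R != 0 :> C by rewrite pnatr_eq0.
pose pC : A := map_mpoly (@real_complex R) p.
have -> : mmap iota (fun k => sqdist Sb (fst_end k) (snd_end k)) p = rho pC.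
  rewrite rmorph_mmap; rewrite /mmap; apply: eq_bigr => m _; congr (_ * _).
  by apply: mmap1_eq => k; rewrite sqdist_sigma // generic_GammaE.
move=> /rhoI pCI.
have pC0 : pC = 0.
  apply: contrapT => nz; apply: (IS pC) => //; split=> //.
  apply/edge_subringE => m.
  rewrite (perm_mem (msupp_map_mpoly _ (fmorph_inj _))); exact: pE.
apply/mpolyP => m; rewrite mcoeff0; apply: (fmorph_inj (@real_complex R)).
by rewrite -mcoeff_map_mpoly -/pC pC0 mcoeff0 rmorph0.
Qed.

End EdgeDistances.

(** * Laplacians, positive definite matrices and the bordered inverse *)

Section Laplacians.

Variables (R : realType) (d : nat).
Notation n := #|{: Defs.lt_pair d}|.
Notation ones := (const_mx 1 : 'cV[R]_d).

Lemma rank1_bilin (u v b : 'cV[R]_d) (c : 'rV[R]_d) :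
  (u^T *m (b *m c) *m v) 0 0 = (u^T *m b) 0 0 * (c *m v) 0 0.
Proof. by rewrite mulmxA -(mulmxA (u^T *m b)) mx11M. Qed.

Definition edge_vec (k : 'I_n) : 'cV[R]_d :=
  delta_mx (fst_end k) 0 - delta_mx (snd_end k) 0.

Definition laplacian (w : 'rV[R]_n) : 'M[R]_d :=
  \sum_k w 0 k *: (edge_vec k *m (edge_vec k)^T).

Lemma laplacianD w z : laplacian (w + z) = laplacian w + laplacian z.
Proof.
by rewrite /laplacian -big_split; apply: eq_bigr => k _; rewrite mxE scalerDl.
Qed.

Lemma laplacianZ a w : laplacian (a *: w) = a *: laplacian w.
Proof.
by rewrite /laplacian scaler_sumr; apply: eq_bigr => k _; rewrite mxE scalerA.
Qed.

Lemma laplacian_sym w : (laplacian w)^T = laplacian w.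
Proof.
rewrite /laplacian linear_sum; apply: eq_bigr => k _.
by rewrite linearZ /= trmx_mul trmxK.
Qed.

Lemma tr_edge_vec_mul k m (A : 'M[R]_(d, m)) j :
  ((edge_vec k)^T *m A) 0 j = A (fst_end k) j - A (snd_end k) j.
Proof.
by rewrite /edge_vec linearB /= !trmx_delta mulmxBl -!rowE !mxE.
Qed.

Lemma laplacian_bilin w (u v : 'cV[R]_d) : (u^T *m laplacian w *m v) 0 0 =
  \sum_k w 0 k * ((u (fst_end k) 0 - u (snd_end k) 0)
                  * (v (fst_end k) 0 - v (snd_end k) 0)).
Proof.
rewrite /laplacian mulmx_sumr mulmx_suml summxE; apply: eq_bigr => k _.
rewrite -scalemxAr -scalemxAl mxE rank1_bilin; congr (_ * (_ * _)).
  by rewrite -mx11_tr trmx_mul trmxK tr_edge_vec_mul.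
by rewrite tr_edge_vec_mul.
Qed.

Lemma qform_laplacian w v :
  qform (laplacian w) v = \sum_k w 0 k * (v (fst_end k) 0 - v (snd_end k) 0) ^+ 2.
Proof. exact: laplacian_bilin. Qed.

Lemma laplacian_ones w : laplacian w *m ones = 0.
Proof.
rewrite /laplacian mulmx_suml big1 // => k _; rewrite -scalemxAl -mulmxA.
rewrite [_^T *m _](_ : _ = 0) ?mulmx0 ?scaler0 //.
by apply/rowP => j; rewrite ord1 tr_edge_vec_mul !mxE subrr.
Qed.

Lemma qform_laplacian_shift w v c :
  qform (laplacian w) (v + c *: ones) = qform (laplacian w) v.
Proof.
by rewrite !qform_laplacian; apply: eq_bigr => k _; rewrite !mxE; congr (_ * _ ^+ 2); ring.
Qed.

Lemma mxtrace_laplacian (A : 'M[R]_d) w :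
  \tr (A *m laplacian w) = \sum_k w 0 k * sqdist A (fst_end k) (snd_end k).
Proof.
rewrite /laplacian mulmx_sumr linear_sum; apply: eq_bigr => k _ /=.
rewrite -scalemxAr linearZ /= mulmxA mxtrace_mulC; congr (_ * _).
rewrite /mxtrace big_ord1 mulmxA sqdistE; congr ((_ *m _ *m _) _ _).
by rewrite /edge_vec linearB /= !trmx_delta.
Qed.

Lemma ones_sum : ones^T *m ones = d%:R%:M.
Proof.
rewrite [LHS]mx11_scalar; congr (_%:M); rewrite mxE.
rewrite (eq_bigr (fun=> 1)) ?sumr_const ?card_ord // => i _.
by rewrite !mxE mulr1.
Qed.

(** The Laplacian completed to be nondegenerate along the constant vectors. *)
Definition completed_laplacian w : 'M[R]_d := laplacian w + ones *m ones^T.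

Lemma qform_completed w v :
  qform (completed_laplacian w) v = qform (laplacian w) v + ((ones^T *m v) 0 0) ^+ 2.
Proof.
rewrite /qform mulmxDr mulmxDl mx11D; congr (_ + _).
rewrite rank1_bilin expr2; congr (_ * _).
by rewrite -mx11_tr trmx_mul trmxK.
Qed.

Lemma completed_laplacian_sym w : (completed_laplacian w)^T = completed_laplacian w.
Proof. by rewrite linearD /= laplacian_sym trmx_mul trmxK. Qed.

Lemma completed_ones w : completed_laplacian w *m ones = d%:R *: ones.
Proof.
by rewrite mulmxDl laplacian_ones add0r -mulmxA ones_sum mul_mx_scalar.
Qed.

Lemma psd_completed w : (forall v, 0 <= qform (laplacian w) v) ->
  psd (completed_laplacian w).
Proof.
move=> w0; split=> [|v]; first exact: completed_laplacian_sym.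
by rewrite -/(qform _ _) qform_completed addr_ge0 ?sqr_ge0.
Qed.

(** The form of a Laplacian ignores constants, so it may be computed on the
    projection of [v], where the added rank one term vanishes. *)
Lemma psd_completed_inv w : (0 < d)%N ->
  (forall v, 0 <= qform (completed_laplacian w) v) ->
  forall v, 0 <= qform (laplacian w) v.
Proof.
move=> d0 w0 v; pose c := - (d%:R^-1 * (ones^T *m v) 0 0).
have := w0 (v + c *: ones); rewrite qform_completed qform_laplacian_shift.
rewrite mulmxDr -scalemxAr mx11D mx11Z ones_sum [d%:R%:M _ _]mxE eqxx mulr1n.
have -> : (ones^T *m v) 0 0 + c * d%:R = 0.
  by rewrite /c; field; rewrite pnatr_eq0 -lt0n.
by rewrite expr0n addr0.
Qed.

End Laplacians.

Section PositiveDefinite.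

Variables (R : realType) (d : nat).
Implicit Types A B : 'M[R]_d.

Lemma psd_factor_square A : psd A -> exists X : 'M[R]_d, A = X *m X^T.
Proof. by move=> pA; exact: psd_factor (rank_leq_row A). Qed.

Lemma psd_det_ge0 A : psd A -> 0 <= \det A.
Proof.
by move=> /psd_factor_square[X ->]; rewrite det_mulmx det_tr -expr2 sqr_ge0.
Qed.

Lemma psd_det_gt0 A : psd A -> (forall v, qform A v = 0 -> v = 0) -> 0 < \det A.
Proof.
move=> pA A0; rewrite lt_neqAle psd_det_ge0 // andbT eq_sym.
rewrite -unitfE -unitmxE -row_free_unit -kermx_eq0; apply/rowV0P => v /sub_kermxP vA.
by apply: trmx_inj; rewrite trmx0; apply: A0; rewrite /qform trmxK vA mul0mx mxE.
Qed.

Lemma psd_unit_gt0 A v : psd A -> A \in unitmx -> v != 0 -> 0 < qform A v.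
Proof.
move=> pA uA v0; rewrite lt_neqAle (proj2 pA v) andbT eq_sym.
apply: contra v0 => /eqP /(psd_radical pA) Av.
by rewrite -[v](mulKmx uA) Av mulmx0.
Qed.

(** A positive definite form dominates a multiple of the squared length of the
    vector: write A = X X^T and recover v from X^T v. *)
Lemma psd_open A B : psd A -> A \in unitmx ->
  exists2 eps, 0 < eps & forall t, `|t| <= eps -> forall v, 0 <= qform (A + t *: B) v.
Proof.
move=> pA uA; have [X AX] := psd_factor_square pA.
have uX : X^T \in unitmx.
  by rewrite unitmx_tr; move: uA; rewrite AX unitmx_mul => /andP[].
pose Z := invmx X^T; pose C := \sum_i \sum_j `|(Z^T *m Z) i j|.
pose b := \sum_i \sum_j `|B i j|.
have C0 : 0 <= C by rewrite sumr_ge0 // => i _; rewrite sumr_ge0.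
have b0 : 0 <= b by rewrite sumr_ge0 // => i _; rewrite sumr_ge0.
have vv v : (v^T *m v) 0 0 <= C * qform A v.
  have := qform_bound (Z^T *m Z) (X^T *m v); rewrite ler_norml => /andP[_].
  have -> : qform (Z^T *m Z) (X^T *m v) = (v^T *m v) 0 0.
    have ZX : Z *m (X^T *m v) = v by rewrite mulmxA mulVmx // mul1mx.
    by rewrite /qform (mulmxA _ Z^T) -(trmx_mul Z) -mulmxA ZX.
  by rewrite trmx_mul trmxK mulmxA -(mulmxA v^T) -AX.
exists (b * C + 1)^-1; first by rewrite invr_gt0 ltr_wpDl // mulr_ge0.
move=> t; rewrite -[leRHS]mul1r ler_pdivlMr ?ltr_wpDl ?mulr_ge0 // => tb v.
have -> : qform (A + t *: B) v = qform A v + t * qform B v.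
  by rewrite /qform mulmxDr mulmxDl -scalemxAr -scalemxAl !mx11E.
have := qform_bound B v; rewrite -/b => qB.
have qA : 0 <= qform A v by exact: (proj2 pA v).
have : `|t * qform B v| <= qform A v.
  rewrite normrM (le_trans (ler_wpM2l (normr_ge0 _) qB)) //.
  rewrite (le_trans (ler_wpM2l (normr_ge0 _) (ler_wpM2l b0 (vv v)))) //.
  rewrite !mulrA -[leRHS]mul1r ler_wpM2r // -mulrA (le_trans _ tb) //.
  by rewrite ler_wpM2l // lerDl.
by rewrite ler_norml => /andP[+ _]; rewrite -subr_ge0 opprK addrC.
Qed.

(** Fermat's rule at 0, for a polynomial. *)
Lemma poly_local_max (q : {poly R}) eps : 0 < eps ->
  (forall t, t != 0 -> `|t| <= eps -> q.[t] <= q`_0) -> q`_1 = 0.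
Proof.
move=> eps0 qmax; pose G := \sum_(i < size q) `|q`_i.+2|.
have G0 : 0 <= G by rewrite sumr_ge0.
have expand t : q.[t] = q`_0 + t * (q`_1 + t * \sum_(i < size q) q`_i.+2 * t ^+ i).
  have sq : (size q <= (size q).+2)%N by rewrite !leqW.
  rewrite (horner_coef_wide _ sq) 2!big_ord_recl /= expr0 mulr1 expr1.
  rewrite (_ : \sum_(i < size q) _ = t * (t * \sum_(i < size q) q`_i.+2 * t ^+ i)).
    by rewrite /bump /=; ring.
  by rewrite !mulr_sumr; apply: eq_bigr => i _; rewrite /bump /= !add1n !exprS; ring.
have bound t : t != 0 -> `|t| <= eps -> `|t| <= 1 -> t * q`_1 <= `|t| * (`|t| * G).
  move=> t0 te t1; have := qmax t t0 te; rewrite expand gerDl mulrDr => h.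
  have : t * q`_1 <= `|t * (t * \sum_(i < size q) q`_i.+2 * t ^+ i)|.
    by rewrite -normrN (le_trans _ (ler_norm _)) // -subr_le0 opprK.
  move=> /le_trans; apply; rewrite !normrM !ler_wpM2l //.
  rewrite (le_trans (ler_norm_sum _ _ _)) // ler_sum // => i _.
  by rewrite normrM normrX ler_piMr // exprn_ile1.
apply/eqP; rewrite -normr_eq0 eq_le normr_ge0 andbT leNgt; apply/negP => c0.
pose s := Num.min eps (Num.min 1 (`|q`_1| / (2 * (G + 1)))).
have s0 : 0 < s by rewrite /s !lt_min eps0 ltr01 /= divr_gt0 // mulr_gt0 // ltr_wpDl.
have [se s1 sc] : [/\ s <= eps, s <= 1 & s <= `|q`_1| / (2 * (G + 1))].
  by rewrite /s !ge_min !lexx !orbT.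
have sG : s * G < `|q`_1|.
  move: sc; rewrite ler_pdivlMr ?mulr_gt0 ?ltr_wpDl // => sc.
  by nra.
pose t := Num.sg q`_1 * s.
have tn : `|t| = s.
  by rewrite /t normrM normr_sg (gtr0_norm s0) -normr_eq0 gt_eqF // mul1r.
have t0 : t != 0 by rewrite -normr_eq0 tn gt_eqF.
have := bound t t0; rewrite tn => /(_ se s1).
rewrite /t mulrAC -normrEsg mulrC ler_pM2l // => /le_lt_trans/(_ sG).
by rewrite ltxx.
Qed.

(** Jacobi: the derivative of t |-> det (A + t B) at 0 is det A tr (A^-1 B); it
    is read off the characteristic polynomial of - A^-1 B. *)
Lemma det_local_max A B eps : A \in unitmx -> 0 < eps ->
  (forall t, `|t| <= eps -> \det (A + t *: B) <= \det A) ->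
  \tr (invmx A *m B) = 0.
Proof.
move=> uA eps0 Amax.
pose M := invmx A *m B; pose c := char_poly (- M).
pose q := \poly_(i < d.+1) (\det A * c`_(d - i)).
have sc : size c = d.+1 by exact: size_char_poly.
have q0 : q`_0 = \det A.
  rewrite coef_poly subn0 /= (_ : c`_d = lead_coef c); last by rewrite lead_coefE sc.
  by rewrite (eqP (char_poly_monic _)) mulr1.
have qE t : t != 0 -> q.[t] = \det (A + t *: B).
  move=> t0.
  have -> : A + t *: B = t *: (A *m (t^-1%:M + M)).
    rewrite mulmxDr mul_mx_scalar mulmxA mulmxV // mul1mx scalerDr scalerA.
    by rewrite divff // scale1r.
  rewrite detZ det_mulmx.
  have -> : \det (t^-1%:M + M) = c.[t^-1].
    rewrite /c /char_poly -horner_evalE -det_map_mx; congr (\det _).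
    apply/matrixP => i j; rewrite !mxE /= horner_evalE !hornerE.
    by rewrite hornerMn hornerX; case: eqP => _; rewrite ?opprK.
  rewrite horner_poly (horner_coef c) sc mulrCA !mulr_sumr.
  rewrite (reindex_inj rev_ord_inj) /=; apply: eq_bigr => i _.
  rewrite subSS subKn ?leq_ord //.
  have h : t ^+ d * t^-1 ^+ i = t ^+ (d - i).
    by rewrite -{1}(subnK (leq_ord i)) exprD exprVn mulfK ?expf_neq0.
  by rewrite -h -mulrA [X in _ = _ * X]mulrCA.
have q1 : q`_1 = 0.
  apply: (poly_local_max eps0) => t t0 te; rewrite q0 qE //; exact: Amax.
have [d0|d0] := posnP d.
  by rewrite /mxtrace big1 // => i _; have := ltn_ord i; rewrite [X in (_ < X)%N]d0.
move: q1; rewrite coef_poly ltnS d0 subn1 char_poly_trace // linearN opprK => /eqP.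
rewrite mulf_eq0 => /orP[/eqP A0|/eqP//].
by move: uA; rewrite unitmxE unitfE A0 eqxx.
Qed.

(** The inverse of the bordered matrix has the blocks L, u, u^T and a scalar, where
    u = L g / 2 + o / d for the diagonal g of S and the constant vector o. *)
Lemma theta_gamma_of (S L : 'M[R]_d) : (0 < d)%N -> S^T = S -> L^T = L ->
  L *m (const_mx 1 : 'cV_d) = 0 ->
  S *m L = 1%:M - d%:R^-1 *: ((const_mx 1 : 'cV_d) *m (const_mx 1 : 'cV_d)^T) ->
  theta (gamma_of S) = L.
Proof.
set o : 'cV[R]_d := const_mx 1 => d0 sS sL Lo SL.
have dn0 : d%:R != 0 :> R by rewrite pnatr_eq0 -lt0n.
have oo : o^T *m o = d%:R%:M by exact: ones_sum.
have oL : o^T *m L = 0 by rewrite -sL -trmx_mul Lo trmx0.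
pose g := diag_col S.
have oT : const_mx 1 = o^T :> 'rV[R]_d by rewrite trmx_const.
have [G Gdef] : exists G, G = - 2%:R^-1 *: gamma_of S by eexists.
have GE : G = S - 2^-1 *: (g *m o^T + o *m g^T).
  rewrite Gdef /gamma_of -/g oT; apply/matrixP => i j; rewrite !mxE; by field.
have sG : G^T = G.
  by rewrite GE linearB /= linearZ /= linearD /= !trmx_mul !trmxK sS (addrC (o *m _)).
pose u := 2^-1 *: (L *m g) + d%:R^-1 *: o.
have GL : G *m L = 1%:M - o *m u^T.
  rewrite GE mulmxBl SL -scalemxAl mulmxDl -!mulmxA oL mulmx0 add0r.
  rewrite /u linearD /= !linearZ /= trmx_mul sL mulmxDr -!scalemxAr opprD.
  by rewrite !scalerN addrA addrAC.
have LG : L *m G = 1%:M - u *m o^T.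
  by rewrite -sL -sG -trmx_mul GL linearB /= trmx1 trmx_mul trmxK.
have ou : o^T *m u = 1%:M.
  rewrite /u mulmxDr -!scalemxAr mulmxA oL mul0mx scaler0 add0r oo.
  by rewrite scale_scalar_mx mulVf.
have LGu : L *m (G *m u) = 0.
  by rewrite mulmxA LG mulmxBl mul1mx -mulmxA ou mulmx1 subrr.
have Gu : G *m u = o *m (d%:R^-1 *: (o^T *m (G *m u))).
  have : S *m (L *m (G *m u)) = 0 by rewrite LGu mulmx0.
  rewrite (mulmxA S) SL mulmxBl mul1mx => /eqP; rewrite subr_eq0 => /eqP h.
  by rewrite [LHS]h -scalemxAr -scalemxAl (mulmxA o).
pose s := - (d%:R^-1 *: (o^T *m (G *m u))).
have inv : block_mx G o o^T (0 : 'M_1) *m block_mx L u u^T s = 1%:M.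
  have Gs : G *m u + o *m s = 0 by rewrite /s mulmxN -Gu subrr.
  rewrite mulmx_block GL subrK Gs oL ou !mul0mx !addr0.
  by rewrite -scalar_mx_block.
rewrite /theta -Gdef -/o oT.
have [unitB _] := mulmx1_unit inv.
have -> : invmx (block_mx G o o^T (0 : 'M_1)) = block_mx L u u^T s.
  by rewrite -[LHS]mulmx1 -inv mulmxA mulVmx // mul1mx.
by rewrite block_mxKul.
Qed.

End PositiveDefinite.

(** * Existence of the estimate in the absence of stresses *)

Section Existence.

Variables (R : realType) (d : nat) (e : rel 'I_d).
Hypotheses (e_sym : ssrbool.symmetric e) (e_irr : irreflexive e)
  (e_conn : forall i j : 'I_d, connect e i j).
Notation n := #|{: Defs.lt_pair d}|.
Notation ones := (const_mx 1 : 'cV[R]_d).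

Lemma continuous_linear_form m (c : 'I_m -> R) :
  continuous (fun w : 'rV[R]_m => \sum_k w 0 k * c k).
Proof.
apply: continuous_big => [|k _ w]; first exact: add_continuous.
by apply: cvgMr_tmp; [exact: nbhs_filter|exact: coord_continuous].
Qed.

Lemma continuous_det_family m (A : 'rV[R]_m -> 'M[R]_d) :
  (forall i j, continuous (fun w => A w i j)) -> continuous (fun w => \det (A w)).
Proof.
move=> Ac; rewrite /determinant.
apply: continuous_big => [|s _ w]; first exact: add_continuous.
apply: cvgMl_tmp; first exact: nbhs_filter.
move: w; by apply: continuous_big => [|i _]; [exact: mul_continuous|exact: Ac].
Qed.

Lemma edge_ends k : k \in edge_set e -> e (fst_end k) (snd_end k).
Proof. by rewrite inE. Qed.

Lemma connected_const (f : 'I_d -> R) :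
  (forall k, k \in edge_set e -> f (fst_end k) = f (snd_end k)) ->
  forall i j, f i = f j.
Proof.
move=> fE i j; have fe a b : e a b -> f a = f b.
  move=> ab; have nab : a != b by apply: contraTneq ab => ->; rewrite e_irr.
  have [k [[ka kb]|[kb ka]]] := endsP nab.
    by rewrite -ka -kb; apply: fE; rewrite inE ka kb.
  by rewrite -ka -kb; apply/esym/fE; rewrite inE ka kb e_sym.
have /connectP[p ep ->] := e_conn i j.
elim: p i ep => [//|a p IH] i /= /andP[ia ap].
by rewrite (fe _ _ ia) IH.
Qed.

Definition stress_cone : set 'rV[R]_n :=
  [set w : 'rV[R]_n | (forall k, k \notin edge_set e -> w 0 k = 0) /\
           forall v, 0 <= qform (laplacian w) v].

Lemma closed_stress_cone : closed stress_cone.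
Proof.
have -> : stress_cone =
    \bigcap_(k in [set k | k \notin edge_set e]) [set w : 'rV[R]_n | w 0 k = 0] `&`
    \bigcap_(v in [set: 'cV[R]_d])
      [set w : 'rV[R]_n | 0 <= \sum_k w 0 k * (v (fst_end k) 0 - v (snd_end k) 0) ^+ 2].
  apply/seteqP; split=> w [w1 w2]; split=> [k /= kE|v].
  - exact: w1.
  - by move=> _ /=; rewrite -qform_laplacian.
  - exact: w1 kE.
  - by rewrite qform_laplacian; exact: w2.
apply: closedI; apply: closed_bigI => i _.
  have : continuous (fun w : 'rV[R]_n => w 0 i) by exact: coord_continuous.
  by move=> /continuous_closedP/(_ _ (@closed_eq R 0)).
have := @continuous_linear_form _ (fun k => (i (fst_end k) 0 - i (snd_end k) 0) ^+ 2).
by move=> /continuous_closedP/(_ _ (@closed_ge R 0)).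
Qed.

Variable S : 'M[R]_d.
Hypothesis pS : psd S.

Definition load (w : 'rV[R]_n) := \sum_k w 0 k * sqdist S (fst_end k) (snd_end k).

Lemma loadE w : load w = \tr (S *m laplacian w).
Proof. by rewrite mxtrace_laplacian. Qed.

Lemma loadD w z : load (w + z) = load w + load z.
Proof. by rewrite !loadE laplacianD mulmxDr linearD. Qed.

Lemma loadZ a w : load (a *: w) = a * load w.
Proof. by rewrite !loadE laplacianZ -scalemxAr linearZ. Qed.

Lemma load_gram r (X : 'M[R]_(d, r)) : S = X *m X^T ->
  forall w, load w = \sum_c qform (laplacian w) (col c X).
Proof.
move=> SX w; rewrite loadE SX -mulmxA mxtrace_mulC /mxtrace; apply: eq_bigr => c _.
rewrite /qform -!mulmxA tr_col -row_mul !mxE; apply: eq_bigr => j _.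
by rewrite !mxE; congr (_ * _); apply: eq_bigr => l _; rewrite !mxE.
Qed.

Lemma load_ge0 w : stress_cone w -> 0 <= load w.
Proof.
move=> [_ w0]; have [X SX] := psd_factor_square pS.
by rewrite (load_gram SX) sumr_ge0.
Qed.

Lemma stress_cone_scale a w : 0 <= a -> stress_cone w -> stress_cone (a *: w).
Proof.
move=> a0 [wE w0]; split=> [k kE|v]; first by rewrite mxE wE // mulr0.
by rewrite laplacianZ /qform -scalemxAr -scalemxAl mx11Z mulr_ge0 //; exact: w0.
Qed.

Hypothesis no_stress : forall w, stress_cone w -> load w = 0 -> w = 0.

(** The only point of the cone with load 0 is the origin, so the load is bounded
    below by a positive multiple of the norm. *)
Lemma compact_load1 : compact (stress_cone `&` [set w : 'rV[R]_n | load w = 1]).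
Proof.
have lc : continuous load by exact: continuous_linear_form.
apply: bounded_closed_compact; last first.
  apply: closedI; first exact: closed_stress_cone.
  by move/continuous_closedP: lc => /(_ _ (@closed_eq R 1)).
(* On the unit sphere of the cone the load has a positive minimum. *)
pose K := stress_cone `&` [set w : 'rV[R]_n | `|w| = 1].
have [K0|K0] := pselect (K !=set0); last first.
  exists 0; split=> // M M0 w [wC w1]; suff -> : w = 0 by rewrite /= normr0 ltW.
  apply/eqP; apply: contrapT => /negP w0; apply: K0; exists (`|w|^-1 *: w); split.
    by apply: stress_cone_scale => //; rewrite invr_ge0.
  by rewrite /= normrZ normfV normr_id mulVf // normr_eq0.
have cK : compact K.
  apply: bounded_closed_compact.
    by exists 1; split=> // M M1 w [_ /= ->]; exact: ltW.
  apply: closedI; first exact: closed_stress_cone.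
  have := @norm_continuous R 'rV[R]_n.
  by move=> /continuous_closedP/(_ _ (@closed_eq R 1)).
have [w1 w1K w1min] := EVT_min_rV K0 cK (continuous_subspaceT lc).
move: w1K; rewrite inE => -[w1C /= w1n].
pose c := load w1; have c0 : 0 < c.
  rewrite lt_neqAle load_ge0 // andbT eq_sym; apply/eqP => /(no_stress w1C) w10.
  by move: w1n; rewrite w10 normr0 => /eqP; rewrite eq_sym oner_eq0.
exists c^-1; split=> [|M cM w [wC /= w1l]]; first by rewrite realE invr_ge0 ltW.
have w0 : `|w| != 0.
  rewrite normr_eq0; apply: contra_eq_neq w1l => ->.
  by rewrite -(scale0r 0) loadZ mul0r eq_sym oner_eq0.
have : c <= load (`|w|^-1 *: w).
  apply: w1min; rewrite inE; split.
    by apply: stress_cone_scale => //; rewrite invr_ge0.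
  by rewrite /= normrZ normfV normr_id mulVf.
have wp : 0 < `|w| by rewrite lt_neqAle eq_sym w0 normr_ge0.
rewrite loadZ w1l mulr1 => h; rewrite (le_trans _ (ltW cM)) //.
by rewrite -[leLHS]invrK lef_pV2 // posrE invr_gt0.
Qed.

Lemma gamma_ofE (A : 'M[R]_d) i j : A^T = A -> gamma_of A i j = sqdist A i j.
Proof.
move=> sA; have Aji : A j i = A i j by rewrite -[in LHS]sA mxE.
by rewrite /gamma_of /sqdist !mxE !big_ord1 !mxE Aji; ring.
Qed.

Lemma laplacian_nonedge (w : 'rV[R]_n) : (forall k, k \notin edge_set e -> w 0 k = 0) ->
  forall i j, i != j -> ~~ e i j -> laplacian w i j = 0.
Proof.
move=> wE i j ij eij.
have -> : laplacian w i j = ((delta_mx i 0 : 'cV_d)^T *m laplacian w *m (delta_mx j 0 : 'cV_d)) 0 0.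
  by rewrite trmx_delta -rowE -colE !mxE.
rewrite laplacian_bilin big1 // => k _.
have [kE|kE] := boolP (k \in edge_set e); last by rewrite wE // mul0r.
have := edge_ends kE; rewrite !mxE !eqxx !andbT.
case: (fst_end k =P i) => [fi|_]; case: (snd_end k =P i) => [si|_];
  case: (fst_end k =P j) => [fj|_]; case: (snd_end k =P j) => [sj|_] ekk;
  rewrite ?subrr ?subr0 ?sub0r ?mulr0 ?mul0r ?mulr0 //.
all: try (by move: ij; rewrite -?fi -?fj -?si -?sj eqxx).
all: try (by move: eij; rewrite -fi -sj ekk).
all: try (by move: eij; rewrite -fj -si e_sym ekk).
Qed.

(** A connected graph without edges has at most one vertex. *)
Lemma surrogate_mle_no_edge :
  (forall k, k \notin edge_set e) -> surrogate_mle_exists e (gamma_of S).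
Proof.
move=> noE.
have all_eq (i j : 'I_d) : i = j.
  pose f a : R := (a == i)%:R.
  have : f i = f j by apply: connected_const => k kE; have := noE k; rewrite kE.
  rewrite /f eqxx => /eqP; case: (j =P i) => [->//|_].
  by rewrite oner_eq0.
exists 0; split; first split.
- by rewrite trmx0.
- by move=> i; rewrite mxE.
- move=> v v0 v1; exfalso; move/eqP: v0; apply; apply/colP => i.
  move/matrixP/(_ 0 0): v1; rewrite !mxE (bigD1 i) //= big1 ?addr0 ?mxE ?mulr1 // => j.
  by rewrite (all_eq j i) eqxx.
- move=> i j; rewrite (all_eq i j) => ejj; by rewrite e_irr in ejj.
- by move=> i j; rewrite (all_eq i j) eqxx.
Qed.

Lemma completed_pos_def (w : 'rV[R]_n) v :
  (forall k, k \notin edge_set e -> w 0 k = 0) ->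
  (forall k, k \in edge_set e -> 0 < w 0 k) ->
  qform (completed_laplacian w) v = 0 -> v = 0.
Proof.
move=> wE wpos; have terms k : 0 <= w 0 k * (v (fst_end k) 0 - v (snd_end k) 0) ^+ 2.
  have [/wpos/ltW w0|/wE->] := boolP (k \in edge_set e); last by rewrite mul0r.
  by rewrite mulr_ge0 ?sqr_ge0.
rewrite qform_completed qform_laplacian => /eqP; rewrite paddr_eq0 ?sqr_ge0 ?sumr_ge0 //.
rewrite sqrf_eq0 psumr_eq0 // => /andP[/allP h1 /eqP h2].
have vconst := @connected_const (fun i => v i 0) _.
have {}vconst i j : v i 0 = v j 0.
  apply: vconst => k kE; have := h1 k (mem_index_enum _).
  by rewrite /= mulf_eq0 gt_eqF ?wpos //= sqrf_eq0 subr_eq0 => /eqP.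
apply/colP => i; rewrite mxE; move: h2; rewrite mxE.
rewrite (eq_bigr (fun=> v i 0)) => [|j _]; last by rewrite !mxE mul1r.
rewrite sumr_const card_ord => /eqP; rewrite mulrn_eq0 => /orP[/eqP d0|/eqP//].
by have := ltn_ord i; rewrite [X in (_ < X)%N]d0.
Qed.

(** If no nonzero positive semidefinite Laplacian annihilates [S], the Laplacians
    of load 1 form a compact set, and the determinant has a maximum on it. The
    maximum is attained at a positive definite point, where stationarity says
    that the inverse has the squared distances of [S] along the edges, up to the
    scalar d - 1. *)
Lemma surrogate_mle_of_no_stress : surrogate_mle_exists e (gamma_of S).
Proof.
have [[k0 k0E]|noE] := pselect (exists k, k \in edge_set e); last first.
  apply: surrogate_mle_no_edge => k; apply/negP => kE; apply: noE; by exists k.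
have d1 : (1 < d)%N.
  exact: leq_ltn_trans (leq_ltn_trans (leq0n _) (ends_lt k0)) (ltn_ord (snd_end k0)).
have d0 : (0 < d)%N by exact: ltnW.
pose w1 : 'rV[R]_n := \row_k (k \in edge_set e)%:R.
have w1C : stress_cone w1.
  split=> [k /negbTE kE|v]; first by rewrite mxE kE.
  by rewrite qform_laplacian sumr_ge0 // => k _; rewrite mulr_ge0 ?sqr_ge0 // mxE ler0n.
have w1l : 0 < load w1.
  rewrite lt_neqAle load_ge0 // andbT eq_sym; apply/eqP => /(no_stress w1C).
  by move/matrixP/(_ 0 k0)/eqP; rewrite !mxE k0E oner_eq0.
pose w2 := (load w1)^-1 *: w1.
have w2C : stress_cone w2 by apply: stress_cone_scale; rewrite ?invr_ge0 ?ltW.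
have w2l : load w2 = 1 by rewrite loadZ mulVf // gt_eqF.
have det2 : 0 < \det (completed_laplacian w2).
  apply: psd_det_gt0; first exact: psd_completed (proj2 w2C).
  move=> v; apply: completed_pos_def (proj1 w2C) _ => k kE.
  by rewrite !mxE kE mulr1 invr_gt0.
have Kne : (stress_cone `&` [set w : 'rV[R]_n | load w = 1]) !=set0 by exists w2.
have detc : continuous (fun w : 'rV[R]_n => \det (completed_laplacian w)).
  apply: continuous_det_family => i j.
  have -> : (fun w : 'rV[R]_n => completed_laplacian w i j) =
      (fun w => \sum_k w 0 k * (edge_vec R k *m (edge_vec R k)^T) i j
                + ((const_mx 1 : 'cV[R]_d) *m (const_mx 1 : 'cV[R]_d)^T) i j).
    apply/funext => w; rewrite /completed_laplacian /laplacian mxE summxE.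
    by congr (_ + _); apply: eq_bigr => k _; rewrite [LHS]mxE.
  move=> w; apply: cvgD; [exact: nbhs_filter| |apply: cvg_cst; exact: nbhs_filter].
  exact: (@continuous_linear_form _ (fun k => (edge_vec R k *m (edge_vec R k)^T) i j)).
have [w wK wmax] := EVT_max_rV Kne compact_load1 (continuous_subspaceT detc).
move: wK; rewrite inE => -[wC /= wl].
have w2K : w2 \in (stress_cone `&` [set w : 'rV[R]_n | load w = 1]) by rewrite inE.
pose A := completed_laplacian w.
have pA : psd A by exact: psd_completed (proj2 wC).
have uA : A \in unitmx.
  by rewrite unitmxE unitfE gt_eqF //; exact: lt_le_trans det2 (wmax _ w2K).
pose D := invmx A; pose o : 'cV[R]_d := const_mx 1.
have dn0 : d%:R != 0 :> R by rewrite pnatr_eq0 -lt0n.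
have sD : D^T = D by rewrite trmx_inv completed_laplacian_sym.
have Do : D *m o = d%:R^-1 *: o.
  by rewrite -[o in RHS](mulKmx uA) completed_ones -scalemxAr scalerA mulVf // scale1r.
have DL : D *m laplacian w = 1%:M - d%:R^-1 *: (o *m o^T).
  have -> : laplacian w = A - o *m o^T by rewrite /A /completed_laplacian addrK.
  by rewrite mulmxBr mulVmx // mulmxA Do scalemxAl.
have trDL : \tr (D *m laplacian w) = d.-1%:R.
  rewrite DL linearB linearZ /= mxtrace1 mxtrace_mulC ones_sum mxtrace_scalar mulr1n.
  by rewrite mulVf // -subn1 natrB.
(* The direction [z] changes the weight of the edge k and keeps the load. *)
have stat k : k \in edge_set e ->
    sqdist D (fst_end k) (snd_end k) = d.-1%:R * sqdist S (fst_end k) (snd_end k).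
  move=> kE; pose g := sqdist S (fst_end k) (snd_end k).
  pose z := delta_mx 0 k - g *: w : 'rV[R]_n.
  have [eps eps0 Aopen] := psd_open (laplacian z) pA uA.
  have AE t : A + t *: laplacian z = completed_laplacian (w + t *: z).
    by rewrite /A /completed_laplacian laplacianD laplacianZ addrAC.
  have tr0 : \tr (D *m laplacian z) = 0.
    apply: (det_local_max uA eps0) => t te; rewrite AE; apply: wmax; rewrite inE; split.
      split=> [j jE|].
        rewrite !mxE (proj1 wC) // eqxx /= mulr0 subr0 add0r.
        by case: eqP => [jk|_]; [rewrite jk kE in jE|rewrite mulr0].
      by apply: psd_completed_inv => // v; rewrite -AE; exact: Aopen.
    rewrite /= loadD loadZ wl /z loadD -scaleNr loadZ wl.
    have -> : load (delta_mx 0 k) = g.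
      rewrite /load (bigD1 k) //= mxE !eqxx mul1r big1 ?addr0 // => j jk.
      by rewrite mxE (negbTE jk) andbF mul0r.
    by rewrite mulr1 subrr mulr0 addr0.
  move: tr0; rewrite /z laplacianD -scaleNr laplacianZ mulmxDr -scalemxAr linearD linearZ /=.
  rewrite trDL mxtrace_laplacian (bigD1 k) //= mxE !eqxx mul1r big1 ?addr0 => [|j jk].
    by move/eqP; rewrite mulNr subr_eq0 mulrC => /eqP.
  by rewrite mxE (negbTE jk) andbF mul0r.
pose c : R := d.-1%:R; have c0 : 0 < c by rewrite ltr0n -subn1 subn_gt0.
pose Sig := c^-1 *: D; pose L := c *: laplacian w.
have sSig : Sig^T = Sig by rewrite linearZ /= sD.
have SigL : Sig *m L = 1%:M - d%:R^-1 *: (o *m o^T).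
  by rewrite -scalemxAr -scalemxAl scalerA mulfV ?gt_eqF // scale1r.
have thetaE : theta (gamma_of Sig) = L.
  apply: theta_gamma_of => //; first by rewrite linearZ /= laplacian_sym.
  by rewrite -scalemxAl laplacian_ones scaler0.
exists (gamma_of Sig); split; first split.
- by apply/matrixP => i j; rewrite mxE !gamma_ofE // sqdistC.
- by move=> i; rewrite gamma_ofE // /sqdist; ring.
- move=> v v0 v1.
  have vG : (v^T *m gamma_of Sig *m v) 0 0 = - 2 * qform Sig v.
    have v1' : const_mx 1 *m v = 0 :> 'M_1.
      by apply: trmx_inj; rewrite trmx_mul trmx_const v1 trmx0.
    rewrite /gamma_of mulmxBr mulmxBl mulmxDr mulmxDl !mulmxA v1 !mul0mx addr0.
    rewrite -[_ *m const_mx 1 *m v]mulmxA v1' mulmx0 add0r.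
    by rewrite -scalemxAr -scalemxAl mx11N mx11Z mulNr.
  rewrite vG mulNr oppr_lt0 mulr_gt0 // /Sig /qform -scalemxAr -scalemxAl mx11Z.
  rewrite mulr_gt0 ?invr_gt0 //.
  have -> : (v^T *m D *m v) 0 0 = qform A (D *m v).
    by rewrite /qform trmx_mul sD !mulmxA mulmxKV // mulmxA.
  apply: psd_unit_gt0 => //; apply: contra v0 => /eqP Dv.
  by rewrite -[v](mulKVmx uA) Dv mulmx0.
- move=> i j eij; have nij : i != j by apply: contraTneq eij => ->; rewrite e_irr.
  rewrite !gamma_ofE //; last by case: pS.
  have sq a b : sqdist Sig a b = c^-1 * sqdist D a b.
    by rewrite /sqdist !mxE; ring.
  rewrite sq; have [k [[ki kj]|[kj ki]]] := endsP nij.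
    rewrite -ki -kj stat ?inE ?ki ?kj //.
    by rewrite mulrA mulVf ?mul1r // gt_eqF.
  rewrite (sqdistC D) (sqdistC S) -ki -kj stat ?inE ?ki ?kj // 1?e_sym //.
  by rewrite mulrA mulVf ?mul1r // gt_eqF.
move=> i j ij eij; rewrite thetaE mxE laplacian_nonedge ?mulr0 //.
exact: (proj1 wC).
Qed.

End Existence.

(** * Polynomial estimates and Hausdorff null sets *)

Section PolynomialEstimates.

Variables (R : realType) (k : nat).
Implicit Types (g : {mpoly R[k]}) (y z : 'I_k -> R).

Definition in_box (B : R) y := forall j, `|y j| <= B.

Definition close (eta : R) y z := forall j, `|z j - y j| <= eta.

Lemma mpoly_lipschitz B g : exists2 C, 0 <= C & forall y, in_box B y ->
  `|g.@[y]| <= C /\ forall z eta, in_box B z -> close eta y z -> 0 <= eta ->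
     `|g.@[z] - g.@[y]| <= C * eta.
Proof.
elim/mpoly_ring_ind: g => [c|i|p q [Cp Cp0 hp] [Cq Cq0 hq]|p q [Cp Cp0 hp] [Cq Cq0 hq]].
- exists `|c| => // y _; rewrite mevalC; split=> // z eta _ _ eta0.
  by rewrite mevalC subrr normr0 mulr_ge0.
- exists (Num.max B 1) => [|y yB]; first by rewrite le_max ler01 orbT.
  rewrite mevalXU; split=> [|z eta _ yz eta0].
    by rewrite (le_trans (yB i)) // le_max lexx.
  by rewrite mevalXU (le_trans (yz i)) // -[leLHS]mul1r ler_wpM2r // le_max lexx orbT.
- exists (Cp + Cq) => [|y yB]; first exact: addr_ge0.
  have [p1 p2] := hp y yB; have [q1 q2] := hq y yB.
  rewrite !mevalD; split=> [|z eta zB yz eta0]; first by rewrite (le_trans (ler_normD _ _)) ?lerD.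
  rewrite mevalD opprD addrACA (le_trans (ler_normD _ _)) // mulrDl.
  by rewrite lerD ?p2 ?q2.
exists (Cp * Cq + (Cp * Cq)) => [|y yB]; first by rewrite addr_ge0 ?mulr_ge0.
have [p1 p2] := hp y yB; have [q1 q2] := hq y yB.
rewrite !mevalM; split=> [|z eta zB yz eta0].
  by rewrite normrM (le_trans (ler_pM _ _ p1 q1)) // lerDl mulr_ge0.
have [pz _] := hp z zB; rewrite mevalM.
have -> : p.@[z] * q.@[z] - p.@[y] * q.@[y] =
    p.@[z] * (q.@[z] - q.@[y]) + (p.@[z] - p.@[y]) * q.@[y] by ring.
rewrite (le_trans (ler_normD _ _)) // [leRHS]mulrDl !normrM lerD //.
  by rewrite -mulrA ler_pM ?q2.
by rewrite [leRHS]mulrAC ler_pM ?p2.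
Qed.

Definition taylor_rest g y z :=
  g.@[z] - g.@[y] - \sum_j (z j - y j) * g^`M(j).@[y].

Lemma mpoly_taylor B g : exists2 C, 0 <= C & forall y z eta,
  in_box B y -> in_box B z -> close eta y z -> 0 <= eta ->
  `|taylor_rest g y z| <= C * eta ^+ 2.
Proof.
rewrite /taylor_rest.
elim/mpoly_ring_ind: g => [c|i|p q [Cp Cp0 hp] [Cq Cq0 hq]|p q [Cp Cp0 hp] [Cq Cq0 hq]].
- exists 0 => // y z eta _ _ _ _; rewrite !mevalC subrr sub0r normrN mul0r.
  by rewrite big1 ?normr0 // => j _; rewrite mderivC meval0 mulr0.
- exists 0 => // y z eta _ _ _ _; rewrite !mevalXU (bigD1 i) //= big1 => [|j ji].
    by rewrite mderiv_var eqxx meval1 mulr1 addr0 subrr normr0 mul0r.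
  by rewrite mderiv_var eq_sym (negbTE ji) meval0 mulr0.
- exists (Cp + Cq) => [|y z eta yB zB yz eta0]; first exact: addr_ge0.
  have := hp y z eta yB zB yz eta0; have := hq y z eta yB zB yz eta0.
  have -> : \sum_j (z j - y j) * (p + q)^`M(j).@[y] =
      \sum_j (z j - y j) * p^`M(j).@[y] + \sum_j (z j - y j) * q^`M(j).@[y].
    by rewrite -big_split; apply: eq_bigr => j _; rewrite mderivD mevalD mulrDr.
  move: (\sum_j _ * p^`M(j).@[y]) (\sum_j _ * q^`M(j).@[y]) => sp sq Hq Hp.
  have -> : (p + q).@[z] - (p + q).@[y] - (sp + sq) =
      (p.@[z] - p.@[y] - sp) + (q.@[z] - q.@[y] - sq) by rewrite !mevalD; ring.
  by rewrite (le_trans (ler_normD _ _)) // mulrDl lerD.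
have [Lp Lp0 lp] := mpoly_lipschitz B p; have [Lq Lq0 lq] := mpoly_lipschitz B q.
exists (Lp * Cq + Lq * Cp + Lp * Lq) => [|y z eta yB zB yz eta0].
  by rewrite !addr_ge0 ?mulr_ge0.
have := hp y z eta yB zB yz eta0; have := hq y z eta yB zB yz eta0.
have [p1 p2] := lp y yB; have [q1 q2] := lq y yB.
have {p2} := p2 z eta zB yz eta0; have {q2} := q2 z eta zB yz eta0.
have -> : \sum_j (z j - y j) * (p * q)^`M(j).@[y] =
    (\sum_j (z j - y j) * p^`M(j).@[y]) * q.@[y]
    + p.@[y] * \sum_j (z j - y j) * q^`M(j).@[y].
  rewrite mulr_suml mulr_sumr -big_split; apply: eq_bigr => j _.
  by rewrite mderivM mevalD !mevalM /=; ring.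
move: (\sum_j _ * p^`M(j).@[y]) (\sum_j _ * q^`M(j).@[y]) => sp sq Hq2 Hp2 Hq Hp.
have -> : (p * q).@[z] - (p * q).@[y] - (sp * q.@[y] + p.@[y] * sq) =
    p.@[y] * (q.@[z] - q.@[y] - sq) + q.@[y] * (p.@[z] - p.@[y] - sp)
    + (p.@[z] - p.@[y]) * (q.@[z] - q.@[y]) by rewrite !mevalM; ring.
rewrite (le_trans (ler_normD _ _)) // [leRHS]mulrDl lerD //; last first.
  by rewrite normrM expr2 mulrACA ler_pM.
rewrite (le_trans (ler_normD _ _)) // [leRHS]mulrDl lerD // normrM -mulrA.
  by rewrite ler_pM.
by rewrite ler_pM.
Qed.

End PolynomialEstimates.

Section HausdorffNull.

Variables (R : realType) (V : normedModType R) (k : nat).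
Implicit Types (A U : set V).

(** Null sets for the measure [hausdorff k], without the supremum over the
    mesh [delta]. *)
Definition hausdorff_null A := forall delta eps : R, 0 < delta -> 0 < eps ->
  exists U : nat -> set V, [/\ A `<=` \bigcup_n U n,
    forall n, (diameter (U n) <= delta%:E)%E
  & (\sum_(n <oo) hausdorff_gauge k (U n) <= eps%:E)%E].

Lemma diameter_le U (b : R) :
  (forall x y, U x -> U y -> `|x - y| <= b) -> (diameter U <= b%:E)%E.
Proof.
move=> Ub; apply: ge_ereal_sup => _ [x [y [Ux Uy ->]]].
by rewrite lee_fin Ub.
Qed.

Lemma diameter_ge0 U x : U x -> (0 <= diameter U)%E.
Proof.
move=> Ux; apply: ereal_sup_ubound; exists x, x; split=> //.
by rewrite subrr normr0.
Qed.

Lemma gauge_ge0 U : (0 <= hausdorff_gauge k U)%E.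
Proof.
rewrite /hausdorff_gauge; case: asboolP => // /eqP/set0P[x Ux].
by rewrite expe_ge0 // (diameter_ge0 Ux).
Qed.

Lemma gauge_le U (b : R) : (diameter U <= b%:E)%E -> 0 <= b ->
  (hausdorff_gauge k U <= (b ^+ k)%:E)%E.
Proof.
move=> Ub b0; rewrite /hausdorff_gauge; case: asboolP => [_|/eqP/set0P[x Ux]].
  by rewrite lee_fin exprn_ge0.
have := diameter_ge0 Ux; case: (diameter U) Ub => [t| |] //.
by rewrite !lee_fin => tb t0; rewrite -EFin_expe lee_fin lerXn2r.
Qed.

Lemma hausdorff_null_eq0 A : hausdorff_null A -> hausdorff k A = 0%E.
Proof.
move=> Anull; apply/eqP; rewrite eq_le; apply/andP; split.
  apply: ge_ereal_sup => _ [delta /= delta0 <-].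
  apply/lee_addgt0Pr => eps eps0; rewrite add0e.
  have [U [AU dU sU]] := Anull delta eps delta0 eps0.
  by apply: le_trans sU; apply: ereal_inf_lbound; exists U.
apply: (@le_trans _ _ (hausdorff_content k 1 A)).
  apply: le_ereal_inf_tmp => _ [U [_ _ ->]].
  by apply: nneseries_ge0 => n _ _; exact: gauge_ge0.
by apply: ereal_sup_ubound; exists 1 => //=.
Qed.

Lemma hausdorff_null0 : hausdorff_null set0.
Proof.
move=> delta eps delta0 eps0; exists (fun=> set0); split=> // [_|].
  by apply: ge_ereal_sup => ? [x [y []]].
rewrite eseries0 => [|m _ _]; first by rewrite lee_fin ltW.
by rewrite /hausdorff_gauge asboolT.
Qed.

Lemma hausdorff_nullS A A' : A `<=` A' -> hausdorff_null A' -> hausdorff_null A.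
Proof.
move=> AA' nA delta eps delta0 eps0; have [U [AU dU sU]] := nA _ _ delta0 eps0.
by exists U; split=> //; exact: subset_trans AU.
Qed.

(** Cover the m-th set with total gauge at most eps / 2^(m+1), and enumerate all
    the covering sets together. *)
Lemma hausdorff_null_bigcup (A : nat -> set V) :
  (forall m, hausdorff_null (A m)) -> hausdorff_null (\bigcup_m A m).
Proof.
move=> nA delta eps delta0 eps0.
have e2 m : 0 < eps / (2 ^ m.+1)%:R by rewrite divr_gt0 // ltr0n expn_gt0.
have [G GP] := choice (fun m => nA m delta _ delta0 (e2 m)).
have /card_esym/ppcard_eqP[f] := card_nat2.
exists (fun n => G (f n).1 (f n).2); split=> [x [m _ Amx]|n|].
- have [AG _ _] := GP m; have [j _ Gx] := AG x Amx.
  by exists (f^-1%FUN (m, j)) => //=; rewrite invK ?inE.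
- by have [_ + _] := GP (f n).1; exact.
rewrite nneseries_esumT; last by move=> n; exact: gauge_ge0.
rewrite -(@reindex_esum R _ _ [set: nat] [set: nat * nat] f
  (fun mj => hausdorff_gauge k (G mj.1 mj.2))); last exact: 'bij_f.
have -> : [set: nat * nat] = [set: nat] `*`` (fun=> [set: nat]).
  by apply/seteqP; split.
rewrite -(esum_esum (a := fun m j => hausdorff_gauge k (G m j))); last first.
  by move=> *; exact: gauge_ge0.
rewrite -nneseries_esumT; last first.
  by move=> m; apply: esum_ge0 => *; exact: gauge_ge0.
have := @epsilon_trick R (fun=> 0%E) eps xpredT (fun=> lexx _) (ltW eps0).
rewrite [X in (_ <= X + _)%E]eseries0 // add0e => /(le_trans _); apply.
apply: lee_nneseries => [m _ _|m _].
  by apply: esum_ge0 => *; exact: gauge_ge0.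
rewrite add0e -nneseries_esumT; last by move=> n; exact: gauge_ge0.
by have [] := GP m.
Qed.

Lemma hausdorff_nullU A A' : hausdorff_null A -> hausdorff_null A' ->
  hausdorff_null (A `|` A').
Proof.
move=> nA nA'; apply: (@hausdorff_nullS _ (\bigcup_m (if m is 0%N then A else A'))).
  by move=> x [Ax|A'x]; [exists 0%N|exists 1%N].
by apply: hausdorff_null_bigcup => -[|m].
Qed.

Lemma hausdorff_null_finite A :
  (forall delta eps : R, 0 < delta -> 0 < eps ->
   exists (T : finType) (U : T -> set V) (b : R),
   [/\ A `<=` [set x | exists t, U t x], 0 <= b, b <= delta,
       #|T|%:R * b ^+ k <= eps
     & forall t x y, U t x -> U t y -> `|x - y| <= b]) ->
  hausdorff_null A.
Proof.
move=> fin delta eps delta0 eps0.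
have [T [U [b [AU b0 bd be Ub]]]] := fin _ _ delta0 eps0.
pose W (m : nat) : set V := [set x | exists t : T, enum_rank t = m :> nat /\ U t x].
have dW m : (diameter (W m) <= b%:E)%E.
  apply: diameter_le => x y [t [tm Utx]] [t' [t'm Uty]].
  have tt' : t = t' by apply/enum_rank_inj/val_inj; rewrite /= tm t'm.
  by rewrite -tt' in Uty; exact: Ub Utx Uty.
exists W; split=> [x /AU[t Utx]|m|].
- by exists (enum_rank t) => //; exists t.
- by apply: (le_trans (dW m)); rewrite lee_fin.
rewrite (nneseries_split _ #|T|); last by move=> m _; exact: gauge_ge0.
rewrite [X in (_ + X)%E]eseries0 ?adde0 => [|m Tm _]; last first.
  rewrite /hausdorff_gauge; case: asboolP => // /eqP/set0P[x [t [tm _]]].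
  by move: Tm; rewrite add0n -tm leqNgt ltn_ord.
rewrite add0n; apply: (@le_trans _ _ (\sum_(0 <= m < #|T|) (b ^+ k)%:E)%E).
  by apply: lee_sum => m _; exact: gauge_le.
by rewrite sumEFin lee_fin sumr_const_nat subn0 -mulr_natl.
Qed.

End HausdorffNull.

(** * Zero sets of polynomials are null *)

Section ZeroSets.

Variables (R : realType) (V : normedModType R) (k : nat).
Variable Phi : ('I_k -> R) -> V.
Hypothesis Phi_lip : forall B, exists2 C, 0 <= C & forall y z eta,
  in_box B y -> in_box B z -> close eta y z -> 0 <= eta -> `|Phi z - Phi y| <= C * eta.

Lemma cell_index (B : R) M : 0 < B -> (0 < M)%N ->
  exists c : R -> 'I_M.+1, forall x x', `|x| <= B -> `|x'| <= B -> c x = c x' ->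
  `|x' - x| <= 2 * B / M%:R.
Proof.
move=> B0 M0; have M0' : 0 < M%:R :> R by rewrite ltr0n.
pose t x : R := (x + B) * M%:R / (2 * B).
have B2 : 0 < 2 * B by rewrite mulr_gt0.
have t0 x : `|x| <= B -> 0 <= t x <= M%:R.
  rewrite ler_norml => /andP[x1 x2]; rewrite /t.
  rewrite divr_ge0 ?(ltW B2) ?mulr_ge0 ?ler0n //=; last by lra.
  by rewrite ler_pdivrMr // [leRHS]mulrC ler_wpM2r ?ler0n //; lra.
have tN x : `|x| <= B -> (Num.truncn (t x) < M.+1)%N.
  move=> /t0/andP[tx0 txM]; rewrite ltnS -(ler_nat R).
  by apply: le_trans txM; case/andP: (Num.Theory.truncn_itv tx0).
exists (fun x => inord (Num.truncn (t x))) => x x' xB x'B.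
move=> /(congr1 val); rewrite /= !inordK ?tN // => txx'.
have /andP[a1 a2] := Num.Theory.truncn_itv (proj1 (andP (t0 _ xB))).
have /andP[b1 b2] := Num.Theory.truncn_itv (proj1 (andP (t0 _ x'B))).
have : `|t x' - t x| <= 1.
  by rewrite txx' in a1 a2; move: a2 b2; rewrite -!natr1 ler_norml; lra.
have -> : t x' - t x = (x' - x) * (M%:R / (2 * B)) by rewrite /t; field; lra.
rewrite normrM (gtr0_norm (divr_gt0 M0' B2)) mulrA ler_pdivrMr // mul1r.
by rewrite ler_pdivlMr.
Qed.

(** By Taylor's formula, two zeros over a small cube of the coordinates other than
    [i] that are not too far apart differ along [i] by at most a constant times the
    side of the cube, wherever the derivative along [i] is not small. *)
Lemma zeros_in_column g i (B : R) : 0 < B ->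
  exists C delta : R, [/\ 0 <= C, 0 < delta &
    forall (h : R) (y z : 'I_k -> R), 0 <= h -> h <= 2 * B ->
    in_box B y -> in_box B z -> g.@[y] = 0 -> g.@[z] = 0 -> B^-1 <= `|g^`M(i).@[y]| ->
    `|z i - y i| <= delta -> (forall j, j != i -> `|z j - y j| <= h) ->
    close (C * h) y z].
Proof.
move=> B0; have [L L0 taylor] := mpoly_taylor B g.
have [D D0 bound] : exists2 D : R, 0 <= D &
    forall (y : 'I_k -> R) j, in_box B y -> `|g^`M(j).@[y]| <= D.
  have /choice[D hD] : forall j, exists D, 0 <= D /\
      forall y : 'I_k -> R, in_box B y -> `|g^`M(j).@[y]| <= D.
    move=> j; have [D D0 hD] := mpoly_lipschitz B g^`M(j).
    by exists D; split=> // y /hD[].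
  exists (\sum_j D j) => [|y j yB]; first by rewrite sumr_ge0 // => j _; case: (hD j).
  rewrite (bigD1 j) //= (le_trans (proj2 (hD j) y yB)) // lerDl sumr_ge0 // => l _.
  by case: (hD l).
pose delta := (2 * B * (L + 1))^-1; have L1 : 0 < L + 1 by rewrite ltr_wpDl.
have delta0 : 0 < delta by rewrite invr_gt0 !mulr_gt0.
have Ldelta : 2 * B * (L * delta) <= 1.
  rewrite /delta; have -> : 2 * B * (L * (2 * B * (L + 1))^-1) = L / (L + 1).
    by field; rewrite !gt_eqF.
  by rewrite ler_pdivrMr // mul1r lerDl.
pose C0 := 2 * B * (6 * B * L + k%:R * D).
have C00 : 0 <= C0 by rewrite !(mulr_ge0, addr_ge0) // ltW.
exists (C0 + 1), delta; split=> // [|h y z h0 hB yB zB gy gz dg sd hcol].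
  by rewrite addr_ge0.
set s := `|z i - y i| in sd *.
have s0 : 0 <= s by rewrite normr_ge0.
have s2B : s <= 2 * B.
  rewrite /s (le_trans (ler_normB _ _)) // mulr2n mulrDl !mul1r lerD //.
have yz : close (h + s) y z.
  move=> j; have [->|ji] := eqVneq j i; first by rewrite -/s lerDr.
  by rewrite (le_trans (hcol j ji)) // lerDl.
have := taylor y z (h + s) yB zB yz (addr_ge0 h0 s0).
rewrite /taylor_rest gy gz subrr sub0r normrN (bigD1 i) //=.
set rest := \sum_(j | j != i) _ => T.
have rest_le : `|rest| <= k%:R * D * h.
  rewrite /rest (le_trans (ler_norm_sum _ _ _)) //.
  apply: (@le_trans _ _ (\sum_(j : 'I_k) D * h)); last first.
    by rewrite sumr_const card_ord -[leLHS]mulr_natl mulrA.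
  rewrite big_mkcond /= ler_sum // => j _; case: ifP => [ji|_].
    by rewrite normrM mulrC ler_pM // ?bound // hcol.
  exact: mulr_ge0.
have main : s * B^-1 <= L * (h + s) ^+ 2 + k%:R * D * h.
  apply: (@le_trans _ _ `|(z i - y i) * g^`M(i).@[y]|).
    by rewrite normrM ler_wpM2l.
  have -> : (z i - y i) * g^`M(i).@[y] =
      ((z i - y i) * g^`M(i).@[y] + rest) - rest by rewrite addrK.
  by rewrite (le_trans (ler_normB _ _)) // lerD.
have sC : s <= C0 * h.
  have sq : L * (h + s) ^+ 2 <= 6 * B * L * h + s * (L * delta).
    have h1 : h * h <= 2 * B * h by rewrite ler_wpM2r.
    have h2 : h * s <= 2 * B * h by rewrite mulrC ler_wpM2r.
    have h3 : s * s <= s * delta by rewrite ler_wpM2l.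
    have : (h + s) ^+ 2 <= 6 * B * h + s * delta by rewrite sqrrD; lra.
    by move=> /(ler_wpM2l L0) /le_trans; apply; rewrite le_eqVlt; apply/orP; left; apply/eqP; ring.
  have : s * B^-1 <= (6 * B * L + k%:R * D) * h + s * (L * delta).
    by rewrite (le_trans main) // mulrDl; lra.
  move=> /(ler_wpM2l (ltW (mulr_gt0 (ltr0n R 2) B0))).
  have -> : 2 * B * (s * B^-1) = 2 * s by field; rewrite gt_eqF.
  rewrite mulrDr.
  have -> : 2 * B * (s * (L * delta)) = s * (2 * B * (L * delta)) by ring.
  have := ler_wpM2l s0 Ldelta; rewrite mulr1 /C0 => h1 h2.
  have -> : 2 * B * (6 * B * L + k%:R * D) * h = 2 * B * ((6 * B * L + k%:R * D) * h) by ring.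
  lra.
move=> j; have [->|ji] := eqVneq j i.
  by rewrite -/s (le_trans sC) // ler_wpM2r // lerDl.
by rewrite (le_trans (hcol j ji)) // mulrDl mul1r lerDr mulr_ge0.
Qed.

(** Cut the box into M^(k-1) columns over cubes of side of order 1/M and each
    column into a fixed number Q of coarse pieces. The zeros in one piece have
    diameter O(1/M), so the sum of the k-th powers of the diameters is
    O(M^(k-1) / M^k), which tends to 0. *)
Lemma null_regular_zeros g i (B : R) : 0 < B ->
  hausdorff_null k (Phi @`
    [set y : 'I_k -> R | [/\ in_box B y, g.@[y] = 0 & B^-1 <= `|g^`M(i).@[y]|]]).
Proof.
move=> B0; have [C [delta0 [C0 delta00 column]]] := zeros_in_column g i B0.
have [L L0 lip] := Phi_lip B.
apply: hausdorff_null_finite => delta eps delta_gt0 eps0.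
pose Q := (Num.bound (2 * B / delta0)).+1.
have Q0 : 0 < Q%:R :> R by rewrite ltr0n.
have QB : 2 * B / Q%:R <= delta0.
  rewrite ler_pdivrMr // [leRHS]mulrC -ler_pdivrMr // ltW //.
  have Bd : 0 <= 2 * B / delta0 by rewrite divr_ge0 ?mulr_ge0 // ltW.
  by apply: lt_trans (Num.Theory.archi_boundP Bd) _; rewrite ltr_nat.
pose W := L * C * (2 * B).
have W0 : 0 <= W by rewrite !mulr_ge0 // ltW.
pose K := (2 ^+ k.-1 * Q.+1%:R) * W ^+ k.
have K0 : 0 <= K by rewrite mulr_ge0 ?exprn_ge0 // mulr_ge0 ?exprn_ge0.
pose M := (Num.bound (W / delta) + Num.bound (K / eps)).+1.
have M0 : 0 < M%:R :> R by rewrite ltr0n.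
have WM : W / M%:R <= delta.
  rewrite ler_pdivrMr // [leRHS]mulrC -ler_pdivrMr // ltW //.
  have Wd : 0 <= W / delta by rewrite divr_ge0 // ltW.
  apply: lt_le_trans (Num.Theory.archi_boundP Wd) _.
  by rewrite ler_nat /M leqW // leq_addr.
have KM : K / M%:R <= eps.
  rewrite ler_pdivrMr // [leRHS]mulrC -ler_pdivrMr // ltW //.
  have Ke : 0 <= K / eps by rewrite divr_ge0 // ltW.
  apply: lt_le_trans (Num.Theory.archi_boundP Ke) _.
  by rewrite ler_nat /M leqW // leq_addl.
have [c cP] := cell_index B0 (isT : (0 < M)%N).
have [q qP] := cell_index B0 (isT : (0 < Q)%N).
pose J : finType := {j : 'I_k | j != i}.
pose T : finType := ({ffun J -> 'I_M.+1} * 'I_Q.+1)%type.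
pose idx (y : 'I_k -> R) : T := ([ffun j => c (y (val j))], q (y i)).
pose Y := [set y : 'I_k -> R | [/\ in_box B y, g.@[y] = 0 & B^-1 <= `|g^`M(i).@[y]|]].
exists T; exists (fun t : T => Phi @` (Y `&` [set y | idx y = t])); exists (W / M%:R).
split=> //.
- by move=> _ [y Yy <-]; exists (idx y), y.
- exact: divr_ge0 W0 (ltW M0).
- have cardJ : #|J| = k.-1 by rewrite card_sig cardC1 card_ord.
  have k0 : (0 < k)%N by exact: leq_ltn_trans (leq0n i) (ltn_ord i).
  rewrite card_prod card_ffun !card_ord cardJ natrM natrX.
  apply: le_trans KM; rewrite /K expr_div_n -mulrA.
  have M2 : M.+1%:R ^+ k.-1 <= 2 ^+ k.-1 * M%:R ^+ k.-1 :> R.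
    rewrite -exprMn lerXn2r ?nnegrE ?mulr_ge0 // -natrM ler_nat mul2n -addnn.
    by rewrite -[M.+1]addn1 leq_add2l.
  have -> : M%:R ^+ k = M%:R ^+ k.-1 * M%:R :> R by rewrite -exprSr prednK.
  set m := M%:R ^+ k.-1 in M2 *; have m0 : 0 < m by rewrite exprn_gt0.
  have -> : 2 ^+ k.-1 * Q.+1%:R * W ^+ k / M%:R =
      (2 ^+ k.-1 * m) * (Q.+1%:R * (W ^+ k / (m * M%:R))).
    by field; rewrite !gt_eqF.
  apply: ler_wpM2r => //.
  by rewrite mulr_ge0 // divr_ge0 ?exprn_ge0 ?mulr_ge0 // ltW.
move=> t _ _ [y [[yB gy dgy] yt] <-] [z [[zB gz dgz] zt] <-].
have [cyz qyz] : (forall j, j != i -> c (y j) = c (z j)) /\ q (y i) = q (z i).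
  have := etrans yt (esym zt) => -[/ffunP e1 e2]; split=> // j ji.
  by have := e1 (exist _ j ji); rewrite !ffunE.
have h0 : 0 <= 2 * B / M%:R by rewrite divr_ge0 ?mulr_ge0 // ltW.
have hB : 2 * B / M%:R <= 2 * B.
  by rewrite ler_pdivrMr // ler_peMr ?mulr_ge0 ?ler1n // ltW.
have yz : close (C * (2 * B / M%:R)) y z.
  apply: (column _ _ _ h0 hB) => // [|j ji]; last by apply: cP => //; exact: cyz.
  by apply: le_trans QB; exact: qP.
rewrite distrC (le_trans (lip y z _ yB zB yz (mulr_ge0 C0 h0))) //.
by rewrite /W !mulrA.
Qed.

(** Zeros where some partial derivative is nonzero are countably many regular
    pieces; the other zeros are zeros of a partial derivative. *)
Lemma null_zeros g : g != 0 -> hausdorff_null k (Phi @` [set y | g.@[y] = 0]).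
Proof.
elim: (msize g) {-2}g (leqnn (msize g)) => {g} [|b IH] g gb g0.
  by move: g0; rewrite -msize_poly_eq0 -leqn0 gb.
have [[i dg]|no] := pselect (exists i, g^`M(i) != 0); last first.
  have gC : g = (g@_0)%:MP.
    apply: mpoly_deriv0_const => i; apply/eqP; apply: contrapT => /negP h.
    by apply: no; exists i.
  apply: (@hausdorff_nullS _ _ _ _ (\bigcup_(m : nat) set0)).
    move=> ? [y /= gy ?]; exfalso; move: g0.
    by rewrite gC -(mevalC y g@_0) -gC gy mpolyC0 eqxx.
  by apply: hausdorff_null_bigcup => m; exact: hausdorff_null0.
have := IH _ _ dg; rewrite -ltnS => /(_ (leq_trans (msize_deriv dg) gb)) nd.
pose Y (m : nat) := [set y : 'I_k -> R | [/\ in_box m.+1%:R y, g.@[y] = 0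
  & m.+1%:R^-1 <= `|g^`M(i).@[y]|]].
apply: (@hausdorff_nullS _ _ _ _
    (Phi @` [set y | g^`M(i).@[y] = 0] `|` \bigcup_m (Phi @` Y m))).
  move=> _ [y /= gy <-]; have [dy|dy] := eqVneq g^`M(i).@[y] 0; first by left; exists y.
  right; have d0 : 0 < `|g^`M(i).@[y]| by rewrite normr_gt0.
  pose m := (Num.bound (\sum_j `|y j|) + Num.bound `|g^`M(i).@[y]|^-1)%N.
  exists m => //; exists y => //; split=> // [j|].
    apply: (@le_trans _ _ (\sum_j `|y j|)).
      by rewrite (bigD1 j) //= lerDl sumr_ge0.
    rewrite ltW // (lt_le_trans (Num.Theory.archi_boundP _)) ?sumr_ge0 //.
    by rewrite ler_nat leqW // leq_addr.
  rewrite -[leRHS]invrK lef_pV2 ?posrE ?invr_gt0 ?ltr0n //.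
  rewrite ltW // (lt_le_trans (Num.Theory.archi_boundP _)) ?invr_ge0 //.
  by rewrite ler_nat leqW // leq_addl.
apply: hausdorff_nullU => //; apply: hausdorff_null_bigcup => m.
exact: null_regular_zeros.
Qed.

End ZeroSets.

(** * The trapezoidal chart and the theorem *)

Section Chart.

Variables (R : realType) (d' r : nat).
Notation d := d'.+1.
Notation n := #|{: Defs.lt_pair d}|.

Definition position := {p : 'I_d' * 'I_r | (p.2 <= p.1)%N}.
Notation K := #|{: position}|.

(** Column l of the chart has d - 1 - l free entries. *)
Lemma card_position : (r <= d')%N -> K = centered_psd_dim d r.
Proof.
move=> rd; transitivity (\sum_(p : 'I_d' * 'I_r | (p.2 <= p.1)%N) 1)%N.
  by rewrite card_sig -sum1_card; apply: eq_bigl.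
rewrite -(pair_big_dep xpredT (fun (i : 'I_d') (l : 'I_r) => (l <= i)%N) (fun _ _ => 1%N)).
rewrite (exchange_big_dep xpredT) //= /centered_psd_dim /=.
rewrite (eq_bigr (fun l : 'I_r => (d' - l)%N)) => [|l _]; last first.
  by rewrite -(big_geq_mkord l d' xpredT (fun=> 1%N)) sum_nat_const_nat muln1.
have -> : (r * d' = \sum_(l < r) d')%N by rewrite sum_nat_const card_ord.
rewrite -bin2_sum big_mkord.
apply/eqP; rewrite -(eqn_add2r (\sum_(i < r) i)) subnK.
  rewrite -big_split /=; apply/eqP/eq_bigr => l _; rewrite subnK //.
  exact: leq_trans (ltnW (ltn_ord l)) rd.
by apply: leq_sum => l _; exact: leq_trans (ltnW (ltn_ord l)) rd.
Qed.

Definition chart_entry (i : 'I_d') (l : 'I_r) : {mpoly R[K]} :=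
  if insub (i, l) is Some p then 'X_(enum_rank (p : position)) else 0.

(** The lower trapezoidal matrices with column sums 0: the last row is determined
    by the others. *)
Definition chart_mx : 'M[{mpoly R[K]}]_(d, r) :=
  \matrix_(i, l) if unlift ord_max i is Some i' then chart_entry i' l
                 else - \sum_i' chart_entry i' l.

Definition chart (y : 'I_K -> R) : 'M[R]_(d, r) := map_mx (meval y) chart_mx.

Definition gram_chart (y : 'I_K -> R) : 'M[R]_d := chart y *m (chart y)^T.

(** The trapezoidal factor has the same Gram matrix as [X], hence also column sums
    0, so that its last row is determined by the others. *)
Lemma gram_chart_surj (X : 'M[R]_(d, r)) : (const_mx 1 : 'rV_d) *m X = 0 ->
  exists y, gram_chart y = X *m X^T.
Proof.
move=> X0; have [Y YY Y0] := trapezoidal_factor X.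
have Ysum l : \sum_i Y i l = 0.
  have : Y^T *m (const_mx 1 : 'cV_d) = 0.
    apply: tr_mul_self_eq0; rewrite trmx_mul trmxK mulmxA -(mulmxA _ Y) YY.
    by rewrite trmx_const mulmxA X0 !mul0mx mxE.
  move/colP/(_ l); rewrite !mxE => h; rewrite -[RHS]h.
  by apply: eq_bigr => i _; rewrite !mxE mulr1.
pose y (p : 'I_K) : R := Y (lift ord_max (val (enum_val p)).1) (val (enum_val p)).2.
exists y; rewrite -YY /gram_chart; suff -> : chart y = Y by [].
have entry i l : (chart_entry i l).@[y] = Y (lift ord_max i) l.
  rewrite /chart_entry; case: insubP => [p _ pE|/= li].
    by rewrite mevalXU /y enum_rankK pE.
  rewrite meval0 Y0 // lift_max.
  by rewrite ltnNge.
apply/matrixP => i l; rewrite !mxE; case: unliftP => [i' ->|->]; first exact: entry.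
rewrite mevalN; have -> : (\sum_i' chart_entry i' l).@[y] = \sum_i' Y (lift ord_max i') l.
  by rewrite raddf_sum; apply: eq_bigr => i' _; exact: entry.
have /eqP := Ysum l; rewrite big_ord_recr /= addrC addr_eq0 => /eqP->; congr (- _).
apply: eq_bigr => j _; congr (Y _ _); apply/val_inj.
by rewrite /= /bump leqNgt ltn_ord.
Qed.

Lemma sqdist_gram (T : comNzRingType) m (X : 'M[T]_(m, r)) i j :
  sqdist (X *m X^T) i j = \sum_c (X i c - X j c) ^+ 2.
Proof.
rewrite /sqdist !mxE -big_split -!sumrB /=; apply: eq_bigr => c _.
by rewrite !mxE; ring.
Qed.

Lemma centered_representative (X : 'M[R]_(d, r)) : exists Y : 'M[R]_(d, r),
  (const_mx 1 : 'rV_d) *m Y = 0 /\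
  forall i j, sqdist (Y *m Y^T) i j = sqdist (X *m X^T) i j.
Proof.
exists (\matrix_(i, c) (X i c - d%:R^-1 * \sum_a X a c)); split=> [|i j].
  apply/rowP => c; rewrite !mxE (eq_bigr (fun i => X i c - d%:R^-1 * \sum_a X a c)).
    rewrite sumrB sumr_const card_ord -[X in _ - X]mulr_natl mulrA mulfV ?pnatr_eq0 // mul1r.
    by rewrite subrr.
  by move=> i _; rewrite !mxE mul1r.
rewrite !sqdist_gram; apply: eq_bigr => c _; rewrite !mxE; congr (_ ^+ 2); ring.
Qed.

Definition edge_poly (k : 'I_n) : {mpoly R[K]} :=
  sqdist (chart_mx *m chart_mx^T) (fst_end k) (snd_end k).

Lemma meval_edge_poly k y :
  (edge_poly k).@[y] = sqdist (gram_chart y) (fst_end k) (snd_end k).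
Proof. by rewrite [LHS]map_sqdist map_mxM -map_trmx. Qed.

(** The coordinates are appended because [jacobian_criterion] completes an
    independent set with some of them. *)
Definition edge_family (a : 'I_(n + K)) : {mpoly R[K]} :=
  match fintype.split a with inl k => edge_poly k | inr j => 'X_j end.

Definition edge_indices (e : rel 'I_d) : {set 'I_(n + K)} :=
  finset (fun a => if fintype.split a is inl k then k \in edge_set e else false).

(** Translating and rotating a configuration does not change its squared
    distances, so a relation valid on the chart is valid for all configurations. *)
Lemma edge_family_indep (e : rel 'I_d) :
  @ideal_JG R[i] d e r = [set 0] -> alg_indep edge_family (edge_indices e).
Proof.
move=> hJ p pE p0.
pose s (a : 'I_(n + K)) : {mpoly R[n]} :=
  match fintype.split a with
  | inl k => if k \in edge_set e then 'X_k else 0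
  | inr _ => 0
  end.
have q0 : msubst s p = 0.
  apply: (edge_distances_independent hJ).
    apply: vars_in_msubst => a; rewrite /s; case: fintype.split => [k|_].
      case: ifP => [kE|_]; first exact: vars_inX.
      by rewrite -mpolyC0; exact: vars_inC.
    by rewrite -mpolyC0; exact: vars_inC.
  move=> X; have [Y [Y0 XY]] := centered_representative X.
  have [y yY] := gram_chart_surj Y0.
  transitivity (msubst edge_family p).@[y]; last by rewrite p0 meval0.
  rewrite !meval_msubst; apply: (eq_mmap_vars_in _ pE) => a.
  rewrite inE /s /edge_family; case: fintype.split => // k kE.
  by rewrite kE mevalXU meval_edge_poly yY XY.
apply: mpoly_vanish => v.
transitivity (msubst s p).@[fun k => v (lshift K k)]; last by rewrite q0 meval0.
rewrite meval_msubst; apply: (eq_mmap_vars_in _ pE) => a.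
rewrite inE /s; case: split_ordP => // k -> kE.
by rewrite kE mevalXU.
Qed.

(** The weighted sum of the squared lengths of a configuration X is the trace of
    X^T L(w) X, whose derivative in a direction Z is 2 tr (X^T L(w) Z). *)
Lemma stress_gradient (w : 'rV[R]_n) y :
  laplacian w *m chart y = 0 ->
  forall l, \sum_k w 0 k * ((edge_poly k)^`M(l)).@[y] = 0.
Proof.
move=> wX l; pose Z := map_mx (fun q => (q^`M(l)).@[y]) chart_mx.
transitivity (\sum_c 2 * ((col c (chart y))^T *m laplacian w *m col c Z) 0 0).
  under [RHS]eq_bigr => c _ do rewrite laplacian_bilin mulr_sumr.
  rewrite exchange_big /=; apply: eq_bigr => k _.
  have -> : ((edge_poly k)^`M(l)).@[y] =
      \sum_c 2 * ((chart y (fst_end k) c - chart y (snd_end k) c)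
                  * (Z (fst_end k) c - Z (snd_end k) c)).
    rewrite /edge_poly sqdist_gram [(\sum_c _)^`M(l)]raddf_sum [(\sum_c _).@[y]]raddf_sum.
    apply: eq_bigr => c _.
    rewrite /= expr2 mderivM mderivB mevalD !mevalM !mevalB ![chart y _ _]mxE ![Z _ _]mxE; ring.
  by rewrite mulr_sumr; apply: eq_bigr => c _; rewrite !mxE; ring.
rewrite big1 // => c _.
have -> : (col c (chart y))^T *m laplacian w = 0.
  by rewrite -(laplacian_sym w) -trmx_mul colE mulmxA wX mul0mx trmx0.
by rewrite mul0mx mxE mulr0.
Qed.

Lemma gram_chart_lipschitz B : exists2 C, 0 <= C & forall y z eta,
  in_box B y -> in_box B z -> close eta y z -> 0 <= eta ->
  `|gram_chart z - gram_chart y| <= C * eta.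
Proof.
pose G := chart_mx *m chart_mx^T.
have /choice[C hC] : forall ij : 'I_d * 'I_d, exists C, 0 <= C /\
    forall y z eta, in_box B y -> in_box B z -> close eta y z -> 0 <= eta ->
    `|(G ij.1 ij.2).@[z] - (G ij.1 ij.2).@[y]| <= C * eta.
  move=> ij; have [C C0 h] := mpoly_lipschitz B (G ij.1 ij.2).
  by exists C; split=> // y z eta yB zB yz eta0; apply: (h y yB).2.
exists (\sum_ij C ij) => [|y z eta yB zB yz eta0].
  by rewrite sumr_ge0 // => ij _; case: (hC ij).
have C0 : 0 <= (\sum_ij C ij) * eta.
  by rewrite mulr_ge0 // sumr_ge0 // => ij _; case: (hC ij).
rewrite [leLHS]mx_normrE; apply: bigmax_le => // ij _.
have GE v : gram_chart v ij.1 ij.2 = (G ij.1 ij.2).@[v].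
  by rewrite /gram_chart /chart map_trmx -map_mxM mxE.
rewrite mxE [(- gram_chart y) _ _]mxE !GE.
rewrite (le_trans ((hC ij).2 y z eta yB zB yz eta0)) // ler_wpM2r //.
by rewrite (bigD1 ij) //= lerDl sumr_ge0 // => kl _; case: (hC kl).
Qed.

End Chart.

Theorem theorem5p4 (R : realType) (d r : nat) (e : rel 'I_d)
    (e_sym : ssrbool.symmetric e) (e_irr : irreflexive e)
    (e_conn : forall i j : 'I_d, connect e i j)
    (hr : (r < d)%N)
    (hJ : @ideal_JG (R[i]) d e r = [set 0%R]%classic) :
  almost_all_centered_psd r
    (fun Sbar : 'M[R]_d => surrogate_mle_exists e (gamma_of Sbar)).
Proof.
case: d e e_sym e_irr e_conn hr hJ => // d' e e_sym e_irr e_conn hr hJ.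
rewrite /almost_all_centered_psd -card_position //.
have coords l : exists a, @edge_family R d' r a = 'X_l.
  by exists (rshift _ l); rewrite /edge_family (unsplitK (inr l : 'I_ _ + 'I_ _)).
have [g g0 gP] := jacobian_criterion (@pchar_num R) coords (edge_family_indep hJ).
apply/hausdorff_null_eq0/hausdorff_nullS; last first.
  exact: null_zeros (@gram_chart_lipschitz R d' r) _ g0.
move=> S [[pS rS S1] /= nomle].
have [X SX] : exists X : 'M[R]_(d'.+1, r), S = X *m X^T by apply: psd_factor; rewrite ?rS.
have X0 : (const_mx 1 : 'rV_d'.+1) *m X = 0.
  apply: trmx_inj; rewrite trmx0 trmx_mul trmx_const; apply: tr_mul_self_eq0.
  by rewrite trmx_mul trmxK mulmxA -(mulmxA _ X) -SX -mulmxA S1 mulmx0 mxE.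
have [y yX] := gram_chart_surj X0; rewrite -SX in yX.
exists y => //=; apply/eqP; apply: contrapT => /negP gy; apply: nomle.
apply: (surrogate_mle_of_no_stress e_sym e_irr e_conn pS) => w [wE w0] wl.
have pL : psd (laplacian w) by split; [exact: laplacian_sym|exact: w0].
have wX : laplacian w *m chart y = 0.
  move: wl; rewrite (load_gram (esym yX)) => /eqP; rewrite psumr_eq0 // => /allP h.
  apply/matrixP => i c; rewrite [RHS]mxE.
  have /eqP/(psd_radical pL) := h c (mem_index_enum _).
  by rewrite colE mulmxA -colE => /colP/(_ i); rewrite mxE [RHS]mxE.
pose u (a : 'I_(#|{: Defs.lt_pair d'.+1}| + #|{: position d' r}|)) : R :=
  match fintype.split a with inl k => w 0 k | inr _ => 0 end.
have u0 : forall a, u a = 0.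
  apply: (gP y gy) => [a|l].
    by rewrite inE /u; case: fintype.split => // k kE; exact: wE.
  rewrite big_split_ord /= [X in _ + X]big1 ?addr0 => [|j _]; last first.
    by rewrite /u (unsplitK (inr j : 'I_ _ + 'I_ _)) mul0r.
  rewrite -[RHS](stress_gradient wX l); apply: eq_bigr => k _.
  by rewrite /u /edge_family (unsplitK (inl k : 'I_ _ + 'I_ _)).
apply/rowP => k; rewrite mxE -[RHS](u0 (lshift _ k)).
by rewrite /u (unsplitK (inl k : 'I_ _ + 'I_ _)).
Qed.
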